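(* Let $R=\mathbb Z$ or $\mathbb F_p$ ($p$ a prime) and let $X$ be a set. Given a map of sets $\tau\colon X\to\mathsf T_R^2(X)$, there is a unique degree-$1$ linear map $d_\tau\colon\mathsf T_R(X)\to\mathsf T_R(X)$ such that $d_\tau(x)=\tau(x)$ for all $x\in X$ and both the $\cup_1$–$d$ formula and the graded Leibniz rule are satisfied.
   Context: $\mathrm{Int}(\mathbb{Z}^X)=\{q\in\mathbb{Q}[X] : q(\mathbb{Z}^X)\subseteq\mathbb{Z}\}$, and $\mathrm{Int}(\mathbb{F}_p^X)$ is the quotient of $\mathrm{Int}(\mathbb{Z}^X)$ by the ideal generated by $\binom{x}{n}$ ($x\in X$, $n\ge p$), tensored with $\mathbb{F}_p$. $\mathfrak{m}_{X,R}\subset \mathrm{Int}(R^X)$ is the submodule of polynomials with zero constant term. The free binomial $\cup_1$-graded algebra is the tensor algebra $\mathsf{T}_R(X)=T^*(\mathfrak{m}_{X,R})$ over $R$ (so $\mathsf T^0=R$, $\mathsf T^1=\mathfrak m_{X,R}\supset X$), with product $\cup=\otimes$ and $R$-linear maps $\cup_1\colon\mathsf T^1\otimes\mathsf T^1\to\mathsf T^1$, $a\cup_1 b=ab$; $\cup_1\colon\mathsf T^2\otimes\mathsf T^1\to\mathsf T^2$, $(a\otimes b)\cup_1 c=ac\otimes b+a\otimes bc$; $\circ\colon\mathsf T^2\otimes\mathsf T^2\to\mathsf T^2$, $(a_1\otimes a_2)\circ(b_1\otimes b_2)=a_1b_1\otimes a_2b_2$. The $\cup_1$–$d$ formula: $d(a\cup_1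 b)=-a\cup b-b\cup a+da\cup_1 b+db\cup_1 a-da\circ db$ for all $a,b\in\mathsf T^1$. The graded Leibniz rule: $d(u\cup v)=du\cup v+(-1)^{|u|}u\cup dv$ for homogeneous $u,v$. (No condition $d_\tau^2=0$ is required.) *)

(* Defs.v *)
From HB Require Import structures.
From mathcomp Require Import all_boot all_order all_algebra all_field.
From mathcomp Require Import generic_quotient ring_quotient.
From mathcomp Require Import finmap.
From mathcomp.multinomials Require Import monalg.
From mathcomp Require Import boolp zify.

Set Implicit Arguments.
Unset Strict Implicit.
Unset Printing Implicit Defensive.

Import Order.TTheory GRing.Theory Num.Theory.

Local Open Scope ring_scope.
Local Open Scope quotient_scope.

Local Notation "1" := (@mone _) : monom_scope.

Lemma sum_mul3 (A : nzRingType) I J (r : seq I) (s : seq J)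
    (F : I -> A) (G : J -> A) (z : A) :
  (\sum_(i <- r) F i) * z * (\sum_(j <- s) G j)
  = \sum_(i <- r) \sum_(j <- s) F i * z * G j.
Proof.
by rewrite !mulr_suml; apply: eq_bigr => i _; rewrite mulr_sumr.
Qed.

Lemma mulr_sum3 (A : nzRingType) I (r : seq I) (F G H : I -> A) (z : A) :
  (\sum_(i <- r) F i * G i * H i) * z = \sum_(i <- r) F i * G i * (H i * z).
Proof. by rewrite mulr_suml; apply: eq_bigr => i _; rewrite mulrA. Qed.

Lemma mull_sum3 (A : nzRingType) I (r : seq I) (F G H : I -> A) (z : A) :
  z * (\sum_(i <- r) F i * G i * H i) = \sum_(i <- r) z * F i * G i * H i.
Proof. by rewrite mulr_sumr; apply: eq_bigr => i _; rewrite !mulrA. Qed.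

Lemma ideal_comb (A : comNzRingType) I (r : seq I) (F G : I -> A)
    (a y1 x2 y2 z : A) :
  a * (\sum_(i <- r) F i * G i + z * y1) + (x2 + z * y2)
  = (\sum_(i <- r) a * F i * G i + x2) + z * (a * y1 + y2).
Proof.
rewrite mulrDr mulrCA addrACA mulrDr mulr_sumr; congr (_ + _ + _).
by apply: eq_bigr => i _; rewrite mulrA.
Qed.

Lemma linear_rel0 (R : nzRingType) (U V : lmodType R) (g : U -> V) c a b e :
  linear g -> g e = c *: g a + g b -> g (e - (c *: a + b)) = 0.
Proof.
by move=> glin ge; rewrite addrC -scaleN1r glin scaleN1r glin ge addNr.
Qed.

Section IntegerValued.
Variable X : choiceType.

Local Notation polyQ := {malg rat[{cmonom X}]}.

Definition mnmeval (v : X -> int) (m : {cmonom X}) : rat :=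
  \prod_(x <- finsupp m) (v x)%:~R ^+ m x.

Lemma mnmevalw v (m : {cmonom X}) (D : {fset X}) : (finsupp m `<=` D)%fset ->
  mnmeval v m = \prod_(x <- D) (v x)%:~R ^+ m x.
Proof.
move=> le; rewrite /mnmeval (big_fset_incl _ le) //= => x _ /fsfun_dflt ->.
by rewrite expr0.
Qed.

Lemma mnmeval_is_mult v : mmorphism (mnmeval v).
Proof.
split=> [m1 m2|]; last by rewrite /mnmeval mdom1 big_seq_fset0.
rewrite (mnmevalw v (fsubsetUl (finsupp m1) (finsupp m2))).
rewrite (mnmevalw v (fsubsetUr (finsupp m1) (finsupp m2))).
rewrite /mnmeval mdomD -big_split /=.
by apply: eq_bigr => x _; rewrite cmM exprD.
Qed.

HB.instance Definition _ v := monalg.isMultiplicative.Build {cmonom X} rat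
  (mnmeval v) (mnmeval_is_mult v).

Definition evalQ (v : X -> int) (q : polyQ) : rat := mmap idfun (mnmeval v) q.

HB.instance Definition _ v := GRing.RMorphism.copy (evalQ v)
  (mmap (GRing.RMorphism.clone rat rat idfun _) (mnmeval v)).

Definition int_valued : {pred polyQ} :=
  fun q => `[< forall v, evalQ v q \is a Num.int >].

Fact int_valued_subring : subring_closed int_valued.
Proof.
split.
- by apply/asboolP => v; rewrite rmorph1 rpred1.
- move=> q r /asboolP hq /asboolP hr; apply/asboolP => v.
  by rewrite rmorphB; apply: rpredB; [exact: hq | exact: hr].
move=> q r /asboolP hq /asboolP hr; apply/asboolP => v.
by rewrite rmorphM; apply: rpredM; [exact: hq | exact: hr].
Qed.
HB.instance Definition _ := GRing.isSubringClosed.Build polyQ int_valued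
  int_valued_subring.

Record IntZ := MkIntZ { intz_val :> polyQ; _ : intz_val \in int_valued }.
HB.instance Definition _ := [isSub for intz_val].
HB.instance Definition _ := [Choice of IntZ by <:].
HB.instance Definition _ := [SubChoice_isSubComNzRing of IntZ by <:].


Fact intz_scaleA a b (q : IntZ) : (q *~ b) *~ a = q *~ (a * b).
Proof. by rewrite mulrzA mulrzAC. Qed.
Fact intz_scaleDr a : {morph (fun q : IntZ => q *~ a) : q r / q + r}.
Proof. by move=> q r; exact: mulrzDl. Qed.
Fact intz_scaleDl (q : IntZ) : {morph (fun a : int => q *~ a) : a b / a + b}.
Proof. by move=> a b; exact: mulrzDr. Qed.
HB.instance Definition _ := GRing.Zmodule_isLmodule.Build int IntZ
  intz_scaleA (@mulr1z IntZ) intz_scaleDr intz_scaleDl.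
Fact intz_scaleAl (a : int) (q r : IntZ) : a *: (q * r) = (a *: q) * r.
Proof. by rewrite /GRing.scale /= mulrzAl. Qed.
HB.instance Definition _ := GRing.Lmodule_isLalgebra.Build int IntZ intz_scaleAl.
HB.instance Definition _ := GRing.Lalgebra_isComAlgebra.Build int IntZ.

Definition varQ (x : X) : polyQ := << ucm x >>.

Lemma evalQ_var v x : evalQ v (varQ x) = (v x)%:~R.
Proof.
by rewrite /evalQ /varQ mmapU mul1r /mnmeval mdomU big_seq_fset1 cmUU expr1.
Qed.

Definition binomQ (x : X) (n : nat) : polyQ :=
  (n`!%:R)^-1 *: \prod_(i < n) (varQ x - i%:R).

Lemma prod_sub_dvd (a : int) n : (n`!%:Z %| \prod_(i < n) (a - i%:Z))%Z.
Proof.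
elim: n => [|n IHn] in a *; first by rewrite big_ord0.
have pos (m : nat) : (n.+1`!%:Z %| \prod_(i < n.+1) (m%:Z - i%:Z))%Z.
  suff -> : \prod_(i < n.+1) (m%:Z - i%:Z) = (m ^_ n.+1)%:Z.
    by rewrite -bin_ffact PoszM dvdz_mull.
  elim: n.+1 => [|k IHk]; first by rewrite big_ord0 ffactn0.
  rewrite big_ord_recr /= IHk ffactnSr PoszM.
  have [km|mk] := leqP k m; first by rewrite subzn.
  by rewrite ffact_small // !mul0r.
case: a => m; first exact: pos.
have -> : \prod_(i < n.+1) (Negz m - i%:Z)
   = (-1) ^+ n.+1 * \prod_(i < n.+1) ((m + n.+1)%:Z - i%:Z).
  rewrite [RHS]mulrC [in RHS](reindex_inj rev_ord_inj) /=.
  have -> : (-1) ^+ n.+1 = \prod_(i < n.+1) (-1) :> int.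
    by rewrite prodr_const card_ord.
  rewrite -big_split /=.
  apply: eq_bigr => i _.
  rewrite NegzE subSS -subzn; last by rewrite -ltnS.
  by lia.
by rewrite dvdz_mull.
Qed.

Fact binomQ_int_valued x n : binomQ x n \in int_valued.
Proof.
apply/asboolP => v; rewrite /evalQ /binomQ mmapZ -/(evalQ v _) /= rmorph_prod.
have -> : \prod_(i < n) evalQ v (varQ x - i%:R)
          = (\prod_(i < n) (v x - i%:Z))%:~R.
  rewrite rmorph_prod; apply: eq_bigr => i _.
  by rewrite rmorphB /= evalQ_var rmorph_nat rmorphB.
have /dvdzP[k ->] := prod_sub_dvd (v x) n.
by rewrite rmorphM /= mulrCA mulVf ?mulr1 ?intr_int // pnatr_eq0 -lt0n fact_gt0.
Qed.

Definition binomZ (x : X) (n : nat) : IntZ := MkIntZ (binomQ_int_valued x n).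

Fact varQ_int_valued x : varQ x \in int_valued.
Proof. by apply/asboolP => v; rewrite evalQ_var intr_int. Qed.

Definition varZ (x : X) : IntZ := MkIntZ (varQ_int_valued x).

Lemma evalQ0 (q : polyQ) : evalQ (fun=> 0) q = q@_1%M.
Proof.
rewrite /evalQ [in RHS](monalgE q) raddf_sum /= mmapE.
apply: eq_bigr => m _; rewrite mcoeffU /mnmeval /=.
have [->|m_neq1] := eqVneq m 1%M; first by rewrite mdom1 big_seq_fset0 mulr1.
have [x x_m] : exists x, x \in finsupp m.
  apply/fset0Pn; apply: contra_neq m_neq1 => m0; apply/eqP/cmP => i.
  by rewrite cm1; apply: fsfun_dflt; rewrite m0.
rewrite (big_fsetD1 x) //= rmorph0 expr0n.
by have := x_m; rewrite mem_finsupp => /negPf->; rewrite mul0r mulr0.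
Qed.

(* Constant terms of integer-valued polynomials are integers. *)
Definition ctermZ (q : IntZ) : int^o := numq (intz_val q)@_1%M.

Lemma ctermZE q : (ctermZ q)%:~R = (intz_val q)@_1%M :> rat.
Proof.
have /asboolP/(_ (fun=> 0)) := valP q; rewrite evalQ0 => /intrP[m Em].
by rewrite /ctermZ [in RHS]Em -/(intz_val q) Em numq_int.
Qed.

Fact ctermZ_is_linear : linear ctermZ.
Proof.
move=> a q r; apply: (@intr_inj rat).
have -> : a *: (ctermZ q : int^o) = (ctermZ q) *~ a by rewrite mulrzz mulrC.
rewrite rmorphD /= raddfMz /= !ctermZE.
have -> : intz_val (a *: q + r) = intz_val q *~ a + intz_val r.
  rewrite [LHS](raddfD (\val : IntZ -> polyQ)); congr (_ + _).
  exact: (raddfMz (\val : IntZ -> polyQ)).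
by rewrite mcoeffD raddfMz.
Qed.
HB.instance Definition _ := GRing.isLinear.Build int IntZ int^o *:%R ctermZ
  ctermZ_is_linear.
Fact ctermZ_is_multiplicative : monoid_morphism ctermZ.
Proof.
split=> [|q r]; apply: (@intr_inj rat); rewrite ctermZE.
  by rewrite /= rmorph1.
by rewrite /= rmorphM /= [in RHS]rmorphM /= !ctermZE.
Qed.
HB.instance Definition _ := GRing.isMonoidMorphism.Build IntZ int^o ctermZ
  ctermZ_is_multiplicative.

Lemma ctermZ_var x : ctermZ (varZ x) = 0.
Proof. by rewrite /ctermZ /= /varQ mcoeffU cm1_eq1. Qed.

Lemma ctermZ_binom x n : (0 < n)%N -> ctermZ (binomZ x n) = 0.
Proof.
case: n => // n _; rewrite /ctermZ /= /binomQ mcoeffZ big_ord_recl subr0.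
by rewrite rmorphM /= mcoeffU cm1_eq1 mul0r mulr0.
Qed.

End IntegerValued.

Section ModP.
Variables (p : nat) (p_pr : prime p) (X : choiceType).

(* Tensoring the quotient by the binomials with F_p amounts to adding p to    *)
(* the generators of the ideal. The primality argument is there so that the   *)
(* ideal instance below can be inferred.                                      *)
Definition binom_ideal & prime p : {pred IntZ X} := fun q =>
  `[< exists (s : seq (IntZ X * (X * nat))) (r : IntZ X),
        all (fun t => p <= t.2.2)%N s /\
        q = \sum_(t <- s) t.1 * binomZ t.2.1 t.2.2 + p%:R * r >].

Fact binom_ideal_closed : idealr_closed (binom_ideal p_pr).
Proof.
split.
- by apply/asboolP; exists [::], 0; rewrite big_nil mulr0 addr0.
- apply/negP => /asboolP[s [r [/allP le_p /(congr1 (@ctermZ X))]]].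
  rewrite rmorph1 rmorphD rmorph_sum /= big_seq big1 => [|t /le_p le_pt].
    rewrite add0r rmorphM /= rmorph_nat => /(congr1 absz).
    have -> : p%:R = p%:Z :> int^o by exact: natz.
    rewrite [X in _ = X]abszM => /esym/eqP.
    by rewrite muln_eq1 absz_nat => /andP[/eqP p1 _]; have := p_pr; rewrite p1.
  by rewrite rmorphM /= ctermZ_binom ?mulr0 // (leq_trans (prime_gt0 p_pr)).
move=> a q1 q2 /asboolP[s1 [r1 [h1 ->]]] /asboolP[s2 [r2 [h2 ->]]].
apply/asboolP; exists ([seq (a * t.1, t.2) | t <- s1] ++ s2), (a * r1 + r2).
rewrite all_cat all_map h1 h2 big_cat big_map /=; split=> //.
exact: ideal_comb.
Qed.

HB.instance Definition _ := isIdealr.Build (IntZ X) (binom_ideal p_pr)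
  binom_ideal_closed.

Fact IntFp_pchar : p \in [pchar {ideal_quot binom_ideal p_pr}].
Proof.
rewrite inE p_pr /= -(rmorph_nat (\pi_({ideal_quot binom_ideal p_pr}))).
rewrite -(rmorph0 (\pi_({ideal_quot binom_ideal p_pr}))) -Quotient.idealrBE subr0.
by apply/asboolP; exists [::], 1; rewrite big_nil add0r mulr1.
Qed.

Definition IntFp : predArgType := pPrimeCharType IntFp_pchar.
HB.instance Definition _ := GRing.ComAlgebra.on IntFp.


Definition redp (q : IntZ X) : IntFp := \pi_({ideal_quot binom_ideal p_pr}) q.

Definition varFp (x : X) : IntFp := redp (varZ x).

Definition ctermFp (q : IntFp) : ('F_p)^o :=
  (ctermZ (repr (q : {ideal_quot binom_ideal p_pr})))%:~R.

Lemma ctermFp_red q : ctermFp (redp q) = (ctermZ q)%:~R.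
Proof.
apply/eqP; rewrite -subr_eq0 -rmorphB /= -rmorphB /=.
have: repr (\pi_({ideal_quot binom_ideal p_pr}) q) - q \in binom_ideal p_pr.
  by rewrite Quotient.idealrBE reprK.
case/asboolP=> s [r [/allP le_p ->]].
have p0 : p%:R = 0 :> ('F_p)^o by rewrite (pchar_Fp_0 p_pr).
rewrite rmorphD rmorph_sum rmorphM /= rmorph_nat.
rewrite big_seq big1 => [|t /le_p le_pt].
  by rewrite add0r rmorphM rmorph_nat /= p0 mul0r.
by rewrite rmorphM /= ctermZ_binom ?mulr0 // (leq_trans (prime_gt0 p_pr)).
Qed.

Lemma redp_surj (q : IntFp) : exists r, q = redp r.
Proof. by exists (repr (q : {ideal_quot binom_ideal p_pr})); rewrite /redp reprK. Qed.

Fact redp_is_zmod_morphism : zmod_morphism redp.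
Proof. by move=> q r; exact: (rmorphB (\pi_({ideal_quot binom_ideal p_pr}))). Qed.
HB.instance Definition _ := GRing.isZmodMorphism.Build (IntZ X) IntFp redp
  redp_is_zmod_morphism.
Fact redp_is_monoid_morphism : monoid_morphism redp.
Proof.
split; first exact: (rmorph1 (\pi_({ideal_quot binom_ideal p_pr}))).
by move=> q r; exact: (rmorphM (\pi_({ideal_quot binom_ideal p_pr}))).
Qed.
HB.instance Definition _ := GRing.isMonoidMorphism.Build (IntZ X) IntFp redp
  redp_is_monoid_morphism.

Fact ctermFp_is_linear : linear ctermFp.
Proof.
move=> a q r; have [q' ->] := redp_surj q; have [r' ->] := redp_surj r.
have -> : a *: redp q' = redp (a%:R * q') by rewrite rmorphM rmorph_nat.
rewrite -rmorphD !ctermFp_red rmorphD rmorphM /= rmorph_nat rmorphD rmorphM.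
by rewrite /= rmorph_nat natr_Zp.
Qed.
HB.instance Definition _ := GRing.isLinear.Build 'F_p IntFp ('F_p)^o *:%R ctermFp
  ctermFp_is_linear.
Fact ctermFp_is_multiplicative : monoid_morphism ctermFp.
Proof.
split=> [|q r]; first by rewrite -(rmorph1 redp) ctermFp_red !rmorph1.
have [q' ->] := redp_surj q; have [r' ->] := redp_surj r.
by rewrite -rmorphM !ctermFp_red !rmorphM.
Qed.
HB.instance Definition _ := GRing.isMonoidMorphism.Build IntFp ('F_p)^o ctermFp
  ctermFp_is_multiplicative.

Lemma ctermFp_var x : ctermFp (varFp x) = 0.
Proof. by rewrite ctermFp_red ctermZ_var. Qed.

End ModP.

Section TensorAlgebra.
Variables (R : comNzRingType) (M : lmodType R).

Local Notation freealg := {malg R[{fmonom M}]}.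

Definition fgen (a : M) : freealg := << fmu a >>.

Definition tensor_rel (c : R) (a b : M) : freealg :=
  fgen (c *: a + b) - (c *: fgen a + fgen b).

(* The two-sided ideal generated by the linearity relations. *)
Definition tensor_ideal : {pred freealg} := fun f =>
  `[< exists s : seq (freealg * (R * M * M) * freealg),
        f = \sum_(t <- s) t.1.1 * tensor_rel t.1.2.1.1 t.1.2.1.2 t.1.2.2 * t.2 >].

Lemma tensor_idealMl f g : g \in tensor_ideal -> f * g \in tensor_ideal.
Proof.
case/asboolP=> s ->; apply/asboolP.
exists [seq (f * t.1.1, t.1.2, t.2) | t <- s].
by rewrite big_map; exact: mull_sum3.
Qed.

Lemma tensor_idealMr f g : g \in tensor_ideal -> g * f \in tensor_ideal.
Proof.
case/asboolP=> s ->; apply/asboolP.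
exists [seq (t.1.1, t.1.2, t.2 * f) | t <- s].
by rewrite big_map; exact: mulr_sum3.
Qed.

Fact tensor_ideal_zmod : zmod_closed tensor_ideal.
Proof.
split=> [|f g]; first by apply/asboolP; exists [::]; rewrite big_nil.
case/asboolP=> s -> /asboolP[s' ->]; apply/asboolP.
exists (s ++ [seq (- t.1.1, t.1.2, t.2) | t <- s']).
rewrite big_cat big_map -sumrN; congr (_ + _).
by apply: eq_bigr => t _; rewrite !mulNr.
Qed.
HB.instance Definition _ := GRing.isZmodClosed.Build freealg tensor_ideal
  tensor_ideal_zmod.

Lemma tensor_ideal1 : 1 \notin tensor_ideal.
Proof.
apply/negP => /asboolP[s /(congr1 (mcoeff 1%M))/eqP].
rewrite rmorph1 rmorph_sum /= big1 ?oner_eq0 // => t _.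
rewrite !rmorphM /= /tensor_rel mcoeffB mcoeffD mcoeffZ /fgen !mcoeffU.
by rewrite !fm1_eq1 mulr0 addr0 subr0 mulr0 mul0r.
Qed.

Definition tensalg : predArgType := Quotient.quot tensor_ideal.
HB.instance Definition _ := GRing.Zmodule.on tensalg.

Definition tproj (f : freealg) : tensalg := \pi_(Quotient.quot tensor_ideal) f.
Definition trepr (t : tensalg) : freealg :=
  repr (t : Quotient.quot tensor_ideal).

Lemma treprK : cancel trepr tproj.
Proof. by move=> t; rewrite /tproj /trepr reprK. Qed.

Lemma tproj_eq f g : f - g \in tensor_ideal -> tproj f = tproj g.
Proof. by move=> fg; apply/eqP; rewrite -Quotient.idealrBE. Qed.

Lemma tproj_repr f : trepr (tproj f) - f \in tensor_ideal.
Proof. by rewrite Quotient.idealrBE reprK. Qed.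

Fact tproj_is_zmod_morphism : zmod_morphism tproj.
Proof. by move=> f g; exact: (raddfB (\pi_(Quotient.quot tensor_ideal))). Qed.
HB.instance Definition _ := GRing.isZmodMorphism.Build freealg tensalg tproj
  tproj_is_zmod_morphism.

Definition tone : tensalg := tproj 1.

End TensorAlgebra.

HB.lock Definition tmul (R : comNzRingType) (M : lmodType R)
  (s t : tensalg M) : tensalg M := tproj (trepr s * trepr t).

HB.lock Definition tscale (R : comNzRingType) (M : lmodType R)
  (c : R) (t : tensalg M) : tensalg M := tproj (c *: trepr t).

HB.lock Definition tin (R : comNzRingType) (M : lmodType R)
  (a : M) : tensalg M := tproj (fgen a).

Section TensorAlgebra.
Variables (R : comNzRingType) (M : lmodType R).

Local Notation freealg := {malg R[{fmonom M}]}.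

Local Notation tensalg := (tensalg M).
Local Notation tmul := (@tmul R M).
Local Notation tscale := (@tscale R M).
Local Notation tone := (tone M).
Local Notation tin := (@tin R M).
Local Notation tproj := (@tproj R M).
Local Notation tensor_ideal := (@tensor_ideal R M).

Lemma tprojM f g : tmul (tproj f) (tproj g) = tproj (f * g).
Proof.
rewrite unlock; apply: tproj_eq; set f' := trepr _; set g' := trepr _.
have -> : f' * g' - f * g = f' * (g' - g) + (f' - f) * g.
  by rewrite mulrBr mulrBl addrA subrK.
apply: rpredD; first exact/tensor_idealMl/tproj_repr.
exact/tensor_idealMr/tproj_repr.
Qed.

Lemma tprojZ c f : tscale c (tproj f) = tproj (c *: f).
Proof.
rewrite unlock; apply: tproj_eq; rewrite -scalerBr -mul_malgC.
exact/tensor_idealMl/tproj_repr.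
Qed.

Fact tmulA : associative tmul.
Proof.
move=> s t u; rewrite -(treprK s) -(treprK t) -(treprK u).
by rewrite !tprojM mulrA.
Qed.
Fact tmul1t : left_id tone tmul.
Proof. by move=> t; rewrite -(treprK t) tprojM mul1r. Qed.
Fact tmult1 : right_id tone tmul.
Proof. by move=> t; rewrite -(treprK t) tprojM mulr1. Qed.
Fact tmulDl : left_distributive tmul +%R.
Proof.
move=> s t u; rewrite -(treprK s) -(treprK t) -(treprK u).
by rewrite -raddfD !tprojM -raddfD mulrDl.
Qed.
Fact tmulDr : right_distributive tmul +%R.
Proof.
move=> s t u; rewrite -(treprK s) -(treprK t) -(treprK u).
by rewrite -raddfD !tprojM -raddfD mulrDr.
Qed.
Fact tone_neq0 : tone != 0.
Proof.
rewrite -(raddf0 tproj); apply: contraNneq (tensor_ideal1 M) => /eqP.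
by rewrite -Quotient.idealrBE subr0.
Qed.
HB.instance Definition _ := GRing.Zmodule_isNzRing.Build tensalg
  tmulA tmul1t tmult1 tmulDl tmulDr tone_neq0.

Fact tscaleA b c t : tscale b (tscale c t) = tscale (b * c) t.
Proof. by rewrite -(treprK t) !tprojZ scalerA. Qed.
Fact tscale1 : left_id 1 tscale.
Proof. by move=> t; rewrite -(treprK t) tprojZ scale1r. Qed.
Fact tscaleDr : right_distributive tscale +%R.
Proof.
move=> c s t; rewrite -(treprK s) -(treprK t).
by rewrite -raddfD !tprojZ -raddfD scalerDr.
Qed.
Fact tscaleDl t : {morph tscale^~ t : b c / b + c}.
Proof. by move=> b c; rewrite -(treprK t) !tprojZ -raddfD scalerDl. Qed.
HB.instance Definition _ := GRing.Zmodule_isLmodule.Build R tensalg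
  tscaleA tscale1 tscaleDr tscaleDl.

Fact tscaleAl (c : R) (s t : tensalg) : c *: (s * t) = (c *: s) * t.
Proof.
rewrite -(treprK s) -(treprK t) /GRing.mul /GRing.scale /=.
by rewrite tprojM !tprojZ tprojM scalerAl.
Qed.
HB.instance Definition _ := GRing.Lmodule_isLalgebra.Build R tensalg tscaleAl.

Lemma freealg_scaleAr (c : R) (f g : freealg) : c *: (f * g) = f * (c *: g).
Proof.
apply/malgP => w; rewrite mcoeffZ [in LHS]mcoeffMl.
rewrite (mcoeffMlw w (fsubset_refl _) (msuppZ_le c g)).
rewrite mulr_sumr; apply: eq_bigr => k1 _; rewrite mulr_sumr.
by apply: eq_bigr => k2 _; rewrite mcoeffZ mulrnAr mulrCA.
Qed.

Fact tscaleAr (c : R) (s t : tensalg) : c *: (s * t) = s * (c *: t).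
Proof.
rewrite -(treprK s) -(treprK t) /GRing.mul /GRing.scale /=.
by rewrite tprojM !tprojZ tprojM freealg_scaleAr.
Qed.
HB.instance Definition _ := GRing.Lalgebra_isAlgebra.Build R tensalg tscaleAr.

Lemma tinE a : tin a = tproj (fgen a).
Proof. by rewrite unlock. Qed.

Fact tin_is_linear : linear tin.
Proof.
move=> c a b; rewrite !tinE -[c *: tproj _]/(tscale _ _) tprojZ -raddfD.
apply: tproj_eq; apply/asboolP; exists [:: (1, (c, a, b), 1)].
by rewrite big_seq1 mul1r mulr1.
Qed.
HB.instance Definition _ := GRing.isLinear.Build R M tensalg *:%R tin
  tin_is_linear.

Definition tdeg (n : nat) (t : tensalg) : Prop :=
  exists s : seq (R * n.-tuple M),
    t = \sum_(w <- s) w.1 *: \prod_(a <- w.2) tin a.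

Section Lift.
Variable V : lmodType R.

Definition fmap_word (h : {fmonom M} -> V) (f : freealg) : V :=
  \sum_(w <- msupp f) f@_w *: h w.

(* The linear maps on the tensor algebra that are given by f on pure tensors  *)
(* of degree 1, resp. 2, and vanish in all other degrees; meaningful only     *)
(* when f is linear, resp. bilinear.                                          *)
Definition tlift1 (f : M -> V) (t : tensalg) : V :=
  fmap_word (fun w => if fmonom_val w is [:: a] then f a else 0) (trepr t).
Definition tlift2 (f : M -> M -> V) (t : tensalg) : V :=
  fmap_word (fun w => if fmonom_val w is [:: a; b] then f a b else 0) (trepr t).

Lemma fmap_wordw h f (D : {fset {fmonom M}}) : (msupp f `<=` D)%fset ->
  fmap_word h f = \sum_(w <- D) f@_w *: h w.
Proof.
move=> le; rewrite /fmap_word (big_fset_incl _ le) //= => w _ /mcoeff_outdom ->.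
by rewrite scale0r.
Qed.

Fact fmap_word_is_linear h : linear (fmap_word h).
Proof.
move=> c f g; pose D := (msupp f `|` msupp g)%fset.
rewrite (@fmap_wordw h (c *: f + g) D); last first.
  apply: fsubset_trans (msuppD_le _ _) _; apply: fsetUSS => //.
  exact: msuppZ_le.
rewrite (@fmap_wordw h f D) ?fsubsetUl // (@fmap_wordw h g D) ?fsubsetUr //.
rewrite scaler_sumr -big_split; apply: eq_bigr => w _ /=.
by rewrite mcoeffD mcoeffZ scalerDl scalerA.
Qed.
HB.instance Definition _ h := GRing.isLinear.Build R freealg V *:%R
  (fmap_word h) (fmap_word_is_linear h).

Lemma fmap_wordU h c w : fmap_word h << c *g w >> = c *: h w.
Proof. by rewrite (fmap_wordw h (msuppU_le)) big_seq_fset1 mcoeffUU. Qed.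

Definition multilinear_word (h : {fmonom M} -> V) := forall u v c a b,
  h (FMonom (u ++ (c *: a + b) :: v)) =
  c *: h (FMonom (u ++ a :: v)) + h (FMonom (u ++ b :: v)).

Lemma fmap_word_ideal h f : multilinear_word h ->
  f \in tensor_ideal -> fmap_word h f = 0.
Proof.
move=> hlin /asboolP[s ->]; rewrite linear_sum big1 //= => t _.
case: t => [[x [[c a] b]] y] /=.
have -> : x * tensor_rel c a b * y = \sum_(u <- msupp x) \sum_(v <- msupp y)
    << x@_u *g u >> * tensor_rel c a b * << y@_v *g v >>.
  by rewrite -sum_mul3 -!monalgE.
rewrite linear_sum big1 //= => u _; rewrite linear_sum big1 //= => v _.
have fgE e : << x@_u *g u >> * fgen e * << y@_v *g v >>
     = << x@_u * y@_v *g FMonom (fmonom_val u ++ e :: fmonom_val v) >> :> freealg.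
  rewrite /fgen !malgM_def !fgmulUU mulr1; congr (<< _ *g _ >>); apply: val_inj => /=.
  by rewrite fmM fmM fmU -catA.
have hE e : fmap_word h (<< x@_u *g u >> * fgen e * << y@_v *g v >>)
     = (x@_u * y@_v) *: h (FMonom (fmonom_val u ++ e :: fmonom_val v)).
  by rewrite fgE fmap_wordU.
move: (<< x@_u *g u >>) (<< y@_v *g v >>) (x@_u * y@_v) hE => x' y' k {fgE} hE.
apply: (@linear_rel0 _ _ _ (fun z => fmap_word h (x' * z * y'))) => [e z1 z2|].
  rewrite mulrDr mulrDl -freealg_scaleAr -scalerAl.
  exact: fmap_word_is_linear.
apply: etrans (hE _) _; rewrite hlin scalerDr scalerA mulrC -scalerA.
by apply: esym; congr (c *: _ + _); exact: hE.
Qed.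

Fact tlift_word_is_linear h : multilinear_word h ->
  linear (fun t => fmap_word h (trepr t)).
Proof.
move=> hlin c s t; rewrite -linearP; apply/eqP; rewrite -subr_eq0 -linearB /=.
rewrite fmap_word_ideal //.
suff -> : c *: s + t = tproj (c *: trepr s + trepr t) by exact: tproj_repr.
by rewrite raddfD /= -tprojZ !treprK.
Qed.

Lemma tlift_wordE h f : multilinear_word h ->
  fmap_word h (trepr (tproj f)) = fmap_word h f.
Proof.
move=> hlin; apply/eqP; rewrite -subr_eq0 -linearB /=.
by rewrite fmap_word_ideal //; exact: tproj_repr.
Qed.

Lemma tlift1_multilinear (f : M -> V) : linear f ->
  multilinear_word (fun w => if fmonom_val w is [:: a] then f a else 0).
Proof.
by move=> flin [|u1 [|u2 u]] [|v1 v] c a b //=; rewrite ?flin ?scaler0 ?addr0.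
Qed.

Lemma tlift2_multilinear (f : M -> M -> V) :
  (forall a, linear (f a)) -> (forall b, linear (f^~ b)) ->
  multilinear_word (fun w => if fmonom_val w is [:: a; b] then f a b else 0).
Proof.
move=> flin1 flin2 [|u1 [|u2 [|u3 u]]] [|v1 [|v2 v]] c a b //=;
  by rewrite ?(flin1, flin2) ?scaler0 ?addr0.
Qed.

Lemma tlift1_linear (f : M -> V) : linear f -> linear (tlift1 f).
Proof. by move/tlift1_multilinear/tlift_word_is_linear. Qed.

Lemma tlift1E (f : M -> V) a : linear f -> tlift1 f (tin a) = f a.
Proof.
move=> /tlift1_multilinear flin; rewrite /tlift1 tinE tlift_wordE // fmap_wordU.
by rewrite fmU scale1r.
Qed.

Lemma tlift2_linear (f : M -> M -> V) :
  (forall a, linear (f a)) -> (forall b, linear (f^~ b)) -> linear (tlift2 f).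
Proof. by move=> f1 f2; apply/tlift_word_is_linear/tlift2_multilinear. Qed.

Lemma tlift2E (f : M -> M -> V) a b :
  (forall a, linear (f a)) -> (forall b, linear (f^~ b)) ->
  tlift2 f (tin a * tin b) = f a b.
Proof.
move=> f1 f2; rewrite !tinE -[_ * _]/(tmul _ _) tprojM /tlift2.
rewrite tlift_wordE; last exact: tlift2_multilinear.
by rewrite malgM_def fgmulUU mulr1 fmap_wordU fmM !fmU scale1r.
Qed.

Lemma fmap_wordP h h1 h2 c f : (forall w, h w = c *: h1 w + h2 w) ->
  fmap_word h f = c *: fmap_word h1 f + fmap_word h2 f.
Proof.
move=> hE; rewrite /fmap_word scaler_sumr -big_split; apply: eq_bigr => w _ /=.
by rewrite hE scalerDr !scalerA mulrC.
Qed.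

Lemma tlift1P (f f1 f2 : M -> V) c t : (forall a, f a = c *: f1 a + f2 a) ->
  tlift1 f t = c *: tlift1 f1 t + tlift1 f2 t.
Proof.
by move=> fE; apply: fmap_wordP => -[[|a [|b w]]] /=; rewrite ?scaler0 ?addr0.
Qed.

Lemma tlift2P (f f1 f2 : M -> M -> V) c t :
  (forall a b, f a b = c *: f1 a b + f2 a b) ->
  tlift2 f t = c *: tlift2 f1 t + tlift2 f2 t.
Proof.
move=> fE; apply: fmap_wordP => -[[|a [|b [|e w]]]] /=;
  by rewrite ?fE ?scaler0 ?addr0.
Qed.

End Lift.

End TensorAlgebra.

Section AugmentationIdeal.
Variables (R : comNzRingType) (A : comAlgType R) (eps : {lrmorphism A -> R^o}).

Definition aug_pred : {pred A} := fun a => eps a == 0.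
Fact aug_pred_submod : submod_closed aug_pred.
Proof.
split=> [|c a b /eqP a0 /eqP b0]; first by rewrite unfold_in raddf0.
by rewrite unfold_in /aug_pred linearP /= a0 b0 scaler0 addr0.
Qed.
HB.instance Definition _ := GRing.isSubmodClosed.Build R A aug_pred
  aug_pred_submod.

Record augideal := AugIdeal { aug_val :> A; _ : aug_val \in aug_pred }.
HB.instance Definition _ := [isSub for aug_val].
HB.instance Definition _ := [Choice of augideal by <:].
HB.instance Definition _ := [SubChoice_isSubLmodule of augideal by <:].

Fact aug_mul_subproof (a b : augideal) : aug_val a * aug_val b \in aug_pred.
Proof.
by rewrite unfold_in /aug_pred rmorphM /=; have /eqP-> := valP a; rewrite mul0r.
Qed.
Definition aug_mul (a b : augideal) : augideal :=
  AugIdeal (aug_mul_subproof a b).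

Lemma aug_mulE a b : aug_val (aug_mul a b) = aug_val a * aug_val b.
Proof. by []. Qed.

Fact aug_mul_linearl b : linear (aug_mul^~ b).
Proof.
by move=> c a1 a2; apply: val_inj; rewrite /= mulrDl scalerAl.
Qed.
Fact aug_mul_linearr a : linear (aug_mul a).
Proof.
by move=> c b1 b2; apply: val_inj; rewrite /= mulrDr scalerAr.
Qed.

Local Notation T := (tensalg augideal).

(* The following operations are extended by zero to all degrees other than    *)
(* (1, 1), (2, 1) and (2, 2) respectively.                                    *)
Definition cup1_11 (s t : T) : T :=
  tlift1 (fun a => tlift1 (fun b => tin (aug_mul a b)) t) s.

Definition cup1_21 (s t : T) : T :=
  tlift2 (fun a b => tlift1 (fun c =>
    tin (aug_mul a c) * tin b + tin a * tin (aug_mul b c)) t) s.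

Definition circ22 (s t : T) : T :=
  tlift2 (fun a1 a2 => tlift2 (fun b1 b2 =>
    tin (aug_mul a1 b1) * tin (aug_mul a2 b2)) t) s.

Let mull (c : R) a1 a2 b :
  aug_mul (c *: a1 + a2) b = c *: aug_mul a1 b + aug_mul a2 b.
Proof. exact: aug_mul_linearl. Qed.
Let mulr_ (c : R) a b1 b2 :
  aug_mul a (c *: b1 + b2) = c *: aug_mul a b1 + aug_mul a b2.
Proof. exact: aug_mul_linearr. Qed.
Let tinP (c : R) a b : tin (c *: a + b) = c *: tin a + tin b :> T.
Proof. exact: linearP. Qed.

Let scAl (c : R) (x y : T) : c *: x * y = c *: (x * y).
Proof. by rewrite -scalerAl. Qed.
Let scAr (c : R) (x y : T) : x * (c *: y) = c *: (x * y).
Proof. by rewrite -scalerAr. Qed.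

Let lin11 a : linear (fun b => tin (aug_mul a b) : T).
Proof. by move=> c b1 b2; rewrite mulr_ tinP. Qed.
Let lin11' t : linear (fun a => tlift1 (fun b => tin (aug_mul a b) : T) t).
Proof. by move=> c a1 a2; apply: tlift1P => b; rewrite mull tinP. Qed.

Lemma cup1_11E a b : cup1_11 (tin a) (tin b) = tin (aug_mul a b).
Proof. by rewrite /cup1_11 !tlift1E. Qed.

Lemma cup1_11_linearl t : linear (cup1_11^~ t).
Proof. exact: tlift1_linear. Qed.

Lemma cup1_11_linearr s : linear (cup1_11 s).
Proof.
by move=> c t1 t2; apply: tlift1P => a; exact: (tlift1_linear (lin11 a)).
Qed.

Let f21 a b c : T := tin (aug_mul a c) * tin b + tin a * tin (aug_mul b c).
Let lin21 a b : linear (f21 a b).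
Proof.
move=> c x y; rewrite /f21 !mulr_ !tinP mulrDl mulrDr scAl scAr.
by rewrite scalerDr addrACA.
Qed.
Let lin21l t a : linear (fun b => tlift1 (f21 a b) t).
Proof.
move=> c b1 b2; apply: tlift1P => x; rewrite /f21 mull !tinP !mulrDr !scAr.
by rewrite scalerDr addrACA.
Qed.
Let lin21r t b : linear (fun a => tlift1 (f21 a b) t).
Proof.
move=> c a1 a2; apply: tlift1P => x; rewrite /f21 mull !tinP !mulrDl !scAl.
by rewrite scalerDr addrACA.
Qed.

Lemma cup1_21E a b c : cup1_21 (tin a * tin b) (tin c)
  = tin (aug_mul a c) * tin b + tin a * tin (aug_mul b c).
Proof.
rewrite /cup1_21 tlift2E; [exact: tlift1E (lin21 a b) | exact: lin21l |].
exact: lin21r.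
Qed.

Lemma cup1_21_linearl t : linear (cup1_21^~ t).
Proof. by apply: tlift2_linear; [exact: lin21l | exact: lin21r]. Qed.

Lemma cup1_21_linearr s : linear (cup1_21 s).
Proof.
move=> c t1 t2; apply: tlift2P => a b; exact: (tlift1_linear (lin21 a b)).
Qed.

Let f22 a1 a2 b1 b2 : T := tin (aug_mul a1 b1) * tin (aug_mul a2 b2).
Let lin22r a1 a2 b1 : linear (f22 a1 a2 b1).
Proof. by move=> c x y; rewrite /f22 mulr_ tinP mulrDr scAr. Qed.
Let lin22l a1 a2 b2 : linear ((f22 a1 a2)^~ b2).
Proof. by move=> c x y; rewrite /f22 mulr_ tinP mulrDl scAl. Qed.
Let lin22rr t a1 : linear (fun a2 => tlift2 (f22 a1 a2) t).
Proof.
by move=> c x y; apply: tlift2P => *; rewrite /f22 mull tinP mulrDr scAr.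
Qed.
Let lin22ll t a2 : linear (fun a1 => tlift2 (f22 a1 a2) t).
Proof.
by move=> c x y; apply: tlift2P => *; rewrite /f22 mull tinP mulrDl scAl.
Qed.

Lemma circ22E a1 a2 b1 b2 : circ22 (tin a1 * tin a2) (tin b1 * tin b2)
  = tin (aug_mul a1 b1) * tin (aug_mul a2 b2).
Proof.
rewrite /circ22 tlift2E; [|exact: lin22rr|exact: lin22ll].
by rewrite tlift2E; [|exact: lin22r|exact: lin22l].
Qed.

Lemma circ22_linearl t : linear (circ22^~ t).
Proof. by apply: tlift2_linear; [exact: lin22rr | exact: lin22ll]. Qed.

Lemma circ22_linearr s : linear (circ22 s).
Proof.
move=> c t1 t2; apply: tlift2P => a1 a2.
exact: (tlift2_linear (lin22r a1 a2) (lin22l a1 a2)).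
Qed.

Definition degree_one (d : T -> T) : Prop :=
  forall n t, tdeg n t -> tdeg n.+1 (d t).

Definition cup1_d_formula (d : T -> T) : Prop :=
  forall a b, tdeg 1 a -> tdeg 1 b ->
    d (cup1_11 a b) = - (a * b) - b * a + cup1_21 (d a) b + cup1_21 (d b) a
                      - circ22 (d a) (d b).

Definition graded_leibniz (d : T -> T) : Prop :=
  forall m n u v, tdeg m u -> tdeg n v ->
    d (u * v) = d u * v + (-1) ^+ m *: (u * d v).

End AugmentationIdeal.

Notation augZ X := (augideal (@ctermZ X)).
Notation augFp p_pr X := (augideal (@ctermFp _ p_pr X)).

Fact genZ_subproof (X : choiceType) (x : X) : varZ x \in aug_pred (@ctermZ X).
Proof. by rewrite unfold_in /aug_pred /= ctermZ_var. Qed.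
Definition genZ (X : choiceType) (x : X) : augZ X := AugIdeal (genZ_subproof x).

Fact genFp_subproof (p : nat) (p_pr : prime p) (X : choiceType) (x : X) :
  varFp p_pr x \in aug_pred (@ctermFp p p_pr X).
Proof. by rewrite unfold_in /aug_pred /= ctermFp_var. Qed.
Definition genFp (p : nat) (p_pr : prime p) (X : choiceType) (x : X) :
  augFp p_pr X := AugIdeal (genFp_subproof p_pr x).

Notation TZ X := (tensalg (augZ X)).
Notation TFp p_pr X := (tensalg (augFp p_pr X)).

(* Main.v *)
Require Import Defs.
From HB Require Import structures.
From mathcomp Require Import all_boot all_order all_algebra.
From mathcomp Require Import generic_quotient ring_quotient finmap.
From mathcomp.multinomials Require Import monalg.
From mathcomp Require Import boolp ring.

(* Let A = Int(R^X), with augmentation ideal m. For a degree-1 map d put      *)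
(* chi a = 1 (x) a + a (x) 1 - d a for a in m and chi 1 = 1. The cup_1-d      *)
(* formula says exactly that chi : A -> A (x) A is a ring homomorphism.       *)
(*   Elements of A are determined by their values at the points of R^X, and   *)
(* products of binomials give a basis of A whose matrix of values is          *)
(* unitriangular; hence elements of A (x) A are determined by their values at *)
(* pairs of points. Evaluating chi at a pair (v, w) gives a homomorphism      *)
(* A -> R, which has to be evaluation at the point                            *)
(* x |-> v x + w x - tau x (v, w), since x determines binom(x, n) up to the   *)
(* factor n! (invertible for n < p when R = F_p, where binom(x, n) = 0        *)
(* otherwise). This gives uniqueness. Existence amounts to                    *)
(* (v, w) |-> a (v + w - tau (v, w)) lying in A (x) A: over Z it is an        *)
(* integer-valued polynomial in the variables X + X, hence an integral        *)
(* combination of products of binomials, and over F_p the algebra A is        *)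
(* generated by X. The Leibniz rule extends d from m to the tensor algebra.   *)

Set Implicit Arguments.
Unset Strict Implicit.
Unset Printing Implicit Defensive.

Import Order.TTheory GRing.Theory Num.Theory.
Local Open Scope ring_scope.
Local Open Scope quotient_scope.

(** * Derivations of the tensor algebra *)

(** Evaluation at pairs of points turns the statement into one about functions: [ev2 v w] sends x
    (x) y in m (x) m to x(v) y(w), and these maps separate elements of degree 2 ([ev2_inj]). The
    cup_1-d formula then says that a |-> a(v) + a(w) - (d a)(v, w) is multiplicative, so rigidity of
    homomorphisms A -> R forces the values of d on m ([ev2_differential]). Conversely,
    [differential_exists] produces elements of m (x) m with these values, and the identities
    required on m can be tested on values. [tder] extends d from m to the tensor algebra, uniquely
    by [eq_leibniz].

    What is specific to R sits in the hypotheses of the section [EvaluationAlgebra]. They rest on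
    the Newton expansion: products of binomials span ([mbinomZ_span]), and their values at exponent
    vectors form a unitriangular matrix ([mbinom_coef]). Composition is [evZ_comp] over Z and
    [evFp_comp] over F_p. *)

Lemma linear_at0 (R : nzRingType) (U V : lmodType R) (f : U -> V) :
  linear f -> f 0 = 0.
Proof.
by move=> f_lin; have := f_lin (-1) 0 0; rewrite scaler0 add0r scaleN1r addNr.
Qed.

Lemma malgU_scale (R : nzRingType) (K : choiceType) (c : R) (k : K) :
  << c *g k >> = c *: << k >> :> {malg R[K]}.
Proof. by apply/malgP => i; rewrite mcoeffZ !mcoeffU mulrnAr mulr1. Qed.

Section TensorDegree.
Variables (R : comNzRingType) (M : lmodType R).
Local Notation T := (tensalg M).
Local Notation word w := (\prod_(a <- w) tin a : T).

Lemma tdeg0 n : tdeg n (0 : T).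
Proof. by exists [::]; rewrite big_nil. Qed.

Lemma tdegP n c (s t : T) : tdeg n s -> tdeg n t -> tdeg n (c *: s + t).
Proof.
case=> us -> [ut ->]; exists ([seq (c * w.1, w.2) | w <- us] ++ ut).
rewrite big_cat big_map scaler_sumr; congr (_ + _).
by apply: eq_bigr => w _; rewrite scalerA.
Qed.

Lemma tdegD n (s t : T) : tdeg n s -> tdeg n t -> tdeg n (s + t).
Proof. by move=> hs ht; rewrite -[s]scale1r; exact: tdegP. Qed.

Lemma tdegZ n c (t : T) : tdeg n t -> tdeg n (c *: t).
Proof. by move=> ht; rewrite -[_ *: _]addr0; exact: tdegP (tdeg0 n). Qed.

Lemma tdegN n (t : T) : tdeg n t -> tdeg n (- t).
Proof. by rewrite -scaleN1r; exact: tdegZ. Qed.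

Lemma tdeg_sum n I (r : seq I) (F : I -> T) :
  (forall i, tdeg n (F i)) -> tdeg n (\sum_(i <- r) F i).
Proof.
by move=> hF; elim/big_ind: _ => //; [exact: tdeg0 | exact: tdegD].
Qed.

Lemma tdeg_word (w : seq M) : tdeg (size w) (word w).
Proof. by exists [:: (1, in_tuple w)]; rewrite big_seq1 scale1r. Qed.

Lemma tdeg_tin a : tdeg 1 (tin a : T).
Proof. by have := tdeg_word [:: a]; rewrite big_seq1. Qed.

Lemma tdeg_ind n (P : T -> Prop) : P 0 ->
    (forall c s t, P s -> P t -> P (c *: s + t)) ->
    (forall w : seq M, size w = n -> P (word w)) ->
  forall t, tdeg n t -> P t.
Proof.
move=> P0 PP Pw t [s ->]; elim: s => [|w s IHs]; first by rewrite big_nil.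
by rewrite big_cons; apply: PP => //; apply: Pw; exact: size_tuple.
Qed.

Lemma tdegM m n (s t : T) : tdeg m s -> tdeg n t -> tdeg (m + n) (s * t).
Proof.
move=> hs ht; elim/(@tdeg_ind m): s / hs => [|c s1 s2 h1 h2|u szu].
- by rewrite mul0r; exact: tdeg0.
- by rewrite mulrDl -scalerAl; exact: tdegP.
elim/(@tdeg_ind n): t / ht => [|c t1 t2 h1 h2|v szv].
- by rewrite mulr0; exact: tdeg0.
- by rewrite mulrDr -scalerAr; exact: tdegP.
by rewrite -big_cat -szu -szv -size_cat; exact: tdeg_word.
Qed.

Lemma tdeg1_tin (t : T) : tdeg 1 t -> exists a, t = tin a.
Proof.
move: t; apply: tdeg_ind => [|c s t [a ->] [b ->]|[|a [|b w]] // _].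
- by exists 0; rewrite linear0.
- by exists (c *: a + b); rewrite linearP.
by exists a; rewrite big_seq1.
Qed.

Lemma tdeg2_ind (P : T -> Prop) : P 0 ->
    (forall c s t, P s -> P t -> P (c *: s + t)) ->
    (forall a b, P (tin a * tin b)) -> forall t, tdeg 2 t -> P t.
Proof.
move=> P0 PP Pw; apply: tdeg_ind => // -[|a [|b [|e w]]] // _.
by rewrite big_cons big_seq1.
Qed.

Lemma tproj_word (w : {fmonom M}) c :
  tproj << c *g w >> = c *: word (fmonom_val w).
Proof.
rewrite malgU_scale -tprojZ; congr (_ *: _); case: w => w /=.
elim: w => [|a w IHw]; first by rewrite big_nil -fmoneE.
rewrite big_cons -IHw tinE -[_ * _]/(tmul _ _) tprojM malgM_def fgmulUU mulr1.
by congr (tproj << _ >>); apply: val_inj; rewrite /= fmM fmU.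
Qed.

Lemma tensalg_ind (P : T -> Prop) : P 0 ->
    (forall c s t, P s -> P t -> P (c *: s + t)) ->
    (forall w : seq M, P (word w)) -> forall t, P t.
Proof.
move=> P0 PP Pw t; rewrite -(treprK t) (monalgE (trepr t)) raddf_sum /=.
elim/big_ind: _ => // [s u Ps Pu|w _]; first by rewrite -[s]scale1r; exact: PP.
by rewrite tproj_word -[_ *: _]addr0; exact: PP.
Qed.

End TensorDegree.

Section Derivation.
Variables (R : comNzRingType) (M : lmodType R).
Local Notation T := (tensalg M).
Local Notation word w := (\prod_(a <- w) tin a : T).
Variable D : M -> T.

(** The Leibniz rule, peeling off the first letter; a letter has odd degree, hence the sign. Working
    on sequences of letters postpones the passage to the quotient. *)
Fixpoint dword (w : seq M) : T :=
  if w is a :: w' then D a * word w' - tin a * dword w' else 0.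

Lemma dword_cat u v :
  dword (u ++ v) = dword u * word v + (-1) ^+ size u *: (word u * dword v).
Proof.
elim: u => [|a u IHu] /=; first by rewrite big_nil mul0r add0r scale1r mul1r.
rewrite IHu big_cat big_cons /= mulrDr opprD addrA mulrBl !mulrA.
by rewrite -scalerAr exprS mulN1r scaleNr !mulrA.
Qed.

Definition tder (t : T) : T :=
  fmap_word (fun w => dword (fmonom_val w)) (trepr t).

Hypothesis D_lin : linear D.

(** By [dword_cat] it suffices to vary the first letter. Multilinearity is what makes [tder] well
    defined on the quotient. *)
Lemma dword_multilinear : multilinear_word (fun w => dword (fmonom_val w)).
Proof.
move=> u v c a b; rewrite !dword_cat.
have -> : word ((c *: a + b) :: v) = c *: word (a :: v) + word (b :: v).
  by rewrite !big_cons linearP mulrDl -scalerAl.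
have -> : dword ((c *: a + b) :: v) = c *: dword (a :: v) + dword (b :: v).
  rewrite /= D_lin linearP !mulrDl -!scalerAl scalerBr opprD.
  by rewrite addrACA.
move: (dword (a :: v)) (dword (b :: v)) => da db.
rewrite !mulrDr -!scalerAr !scalerDr ![_ *: (c *: _)]scalerA.
by rewrite [_ * c]mulrC -scalerA addrACA.
Qed.

Lemma tder_linear : linear tder.
Proof. exact: tlift_word_is_linear dword_multilinear. Qed.

Lemma tder_word w : tder (word w) = dword w.
Proof.
have -> : word w = tproj << FMonom w >> by rewrite tproj_word scale1r.
by rewrite /tder tlift_wordE ?fmap_wordU ?scale1r //; exact: dword_multilinear.
Qed.

Lemma tder_tin a : tder (tin a) = D a.
Proof.
have := tder_word [:: a]; rewrite big_seq1 => ->.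
by rewrite /= big_nil mulr1 mulr0 subr0.
Qed.

Lemma tder_leibniz m n (u v : T) : tdeg m u -> tdeg n v ->
  tder (u * v) = tder u * v + (-1) ^+ m *: (u * tder v).
Proof.
pose dL := GRing.isLinear.Build R T T *:%R tder tder_linear.
pose d : {linear T -> T} := HB.pack tder dL.
have dE t : tder t = d t by [].
move=> hu hv; rewrite !dE.
elim/(@tdeg_ind R M m): u / hu => [|c u1 u2 h1 h2|u szu].
- by rewrite !mul0r linear0 mul0r scaler0 addr0.
- rewrite mulrDl -scalerAl !linearP h1 h2 !mulrDl -!scalerAl.
  by rewrite !scalerDr addrACA !scalerA mulrC.
elim/(@tdeg_ind R M n): v / hv => [|c v1 v2 h1 h2|v szv].
- by rewrite !mulr0 linear0 !mulr0 scaler0 addr0.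
- rewrite mulrDr -scalerAr !linearP h1 h2 !mulrDr -!scalerAr.
  by rewrite !scalerDr addrACA !scalerA mulrC.
by rewrite -big_cat -!dE !tder_word dword_cat szu.
Qed.

Lemma tder_degree n t : (forall a, tdeg 2 (D a)) -> tdeg n t ->
  tdeg n.+1 (tder t).
Proof.
move=> hD; move: t; apply: tdeg_ind => [|c s t hs ht|w <-].
- by rewrite linear_at0 //; [exact: tdeg0 | exact: tder_linear].
- by rewrite tder_linear; exact: tdegP.
rewrite tder_word; elim: w => [|a w IHw] /=; first exact: tdeg0.
apply: tdegD; first exact: tdegM (hD a) (tdeg_word w).
by apply: tdegN; exact: tdegM (tdeg_tin a) IHw.
Qed.

End Derivation.

(** Words are products of letters, so the Leibniz rule reduces the claim to letters and to 1, where
    it forces the value 0: [f 1 = f 1 + f 1]. *)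
Lemma eq_leibniz (R : comNzRingType) (M : lmodType R)
    (d d' : tensalg M -> tensalg M) :
    linear d -> linear d' ->
    (forall m n u v, tdeg m u -> tdeg n v ->
       d (u * v) = d u * v + (-1) ^+ m *: (u * d v)) ->
    (forall m n u v, tdeg m u -> tdeg n v ->
       d' (u * v) = d' u * v + (-1) ^+ m *: (u * d' v)) ->
  (forall a, d (tin a) = d' (tin a)) -> d = d'.
Proof.
move=> dlin d'lin dL d'L dE; apply/funext => t.
have leib1 f : (forall m n u v, tdeg m u -> tdeg n v ->
    f (u * v) = f u * v + (-1) ^+ m *: (u * f v)) -> f 1 = 0 :> tensalg M.
  have t1 : tdeg 0 (1 : tensalg M).
    by have := tdeg_word (nil : seq M); rewrite big_nil.
  move=> fL; have := fL 0%N 0%N 1 1 t1 t1.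
  by rewrite mulr1 !mul1r expr0 scale1r mulr1 -[X in X = _]addr0 => /addrI.
elim/tensalg_ind: t => [|c s t hs ht|w]; first by rewrite !linear_at0.
  by rewrite dlin d'lin hs ht.
elim: w => [|a w IHw]; first by rewrite big_nil !leib1.
rewrite big_cons (dL _ _ _ _ (tdeg_tin a) (tdeg_word w)).
by rewrite (d'L _ _ _ _ (tdeg_tin a) (tdeg_word w)) dE IHw.
Qed.

(** * Evaluation at pairs of points *)

(** Collects the terms with equal index. Additive maps [F i] cover both linear combinations and sums
    of tensors with one factor in a fixed family. *)
Lemma sum_undup (I : eqType) (V W : zmodType) (F : I -> V -> W)
    (s : seq (V * I)) : (forall i, zmod_morphism (F i)) ->
  \sum_(t <- s) F t.2 t.1
  = \sum_(i <- undup [seq t.2 | t <- s]) F i (\sum_(t <- s | t.2 == i) t.1).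
Proof.
move=> F_add.
have F_sum i : F i (\sum_(t <- s | t.2 == i) t.1)
    = \sum_(t <- s | t.2 == i) F i t.1.
  have F0 : F i 0 = 0 by rewrite -[0 in LHS](subrr 0) F_add subrr.
  elim/big_rec2: _ => // t x y _ <-.
  by rewrite -{1}[y]opprK F_add -[- y]add0r F_add F0 add0r opprK.
rewrite (eq_bigr _ (fun i _ => F_sum i)) (exchange_big_dep xpredT) //= big_seq.
rewrite [RHS]big_seq; apply: eq_bigr => t t_s.
rewrite big_mkcond (bigD1_seq t.2) ?undup_uniq ?mem_undup ?map_f //= eqxx.
by rewrite big1 ?addr0 // => i; rewrite eq_sym => /negPf->.
Qed.

Section Span.
Variables (K : comNzRingType) (I : Type).

Definition in_span (V : lmodType K) (b : I -> V) (g : V) : Prop :=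
  exists s : seq (K * I), g = \sum_(w <- s) w.1 *: b w.2.

Variables (V : lmodType K) (b : I -> V).

Lemma in_spanP c g h : in_span b g -> in_span b h -> in_span b (c *: g + h).
Proof.
case=> s -> [t ->]; exists ([seq (c * w.1, w.2) | w <- s] ++ t).
rewrite big_cat big_map scaler_sumr; congr (_ + _).
by apply: eq_bigr => w _; rewrite scalerA.
Qed.

Lemma in_span0 : in_span b 0.
Proof. by exists [::]; rewrite big_nil. Qed.

Lemma in_spanD g h : in_span b g -> in_span b h -> in_span b (g + h).
Proof. by rewrite -{2}[g]scale1r; exact: in_spanP. Qed.

Lemma in_spanZ c g : in_span b g -> in_span b (c *: g).
Proof. by move=> hg; rewrite -[_ *: _]addr0; exact: in_spanP in_span0. Qed.

Lemma in_span_gen i : in_span b (b i).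
Proof. by exists [:: (1, i)]; rewrite big_seq1 scale1r. Qed.

End Span.

Lemma in_span_uniq (K : comNzRingType) (I : eqType) (V : lmodType K)
    (b : I -> V) g : in_span b g ->
  exists s (c : I -> K), uniq s /\ g = \sum_(i <- s) c i *: b i.
Proof.
case=> s ->; exists (undup [seq w.2 | w <- s]).
exists (fun i => \sum_(w <- s | w.2 == i) w.1); split; first exact: undup_uniq.
rewrite (@sum_undup I K V (fun i c => c *: b i)) // => i x y.
by rewrite scalerBl.
Qed.

Lemma in_spanMl (K : comNzRingType) (B : comAlgType K) I (b : I -> B) u g :
  (forall i, in_span b (u * b i)) -> in_span b g -> in_span b (u * g).
Proof.
move=> ub [s ->]; elim: s => [|w s IHs].
  by rewrite big_nil mulr0; exact: in_span0.
by rewrite big_cons mulrDr -scalerAr; exact: in_spanP.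
Qed.

Section EvaluationAlgebra.
Variables (R : comNzRingType) (A : comAlgType R) (eps : {lrmorphism A -> R^o}).
Variables (X : Type) (ev : (X -> R) -> {lrmorphism A -> R | *%R}).
Variable var : X -> A.
Variables (I : eqType) (b : I -> A) (P : pred I).

Local Notation M := (augideal eps).
Local Notation T := (tensalg M).

(** In both applications [b] runs through the products of binomials and [P] selects those that form
    a basis of m; the others are constants. *)
Hypothesis eps_ev : forall a, eps a = ev (fun=> 0) a.
Hypothesis ev_var : forall v x, ev v (var x) = v x.
Hypothesis b_span : forall a, in_span b a.
Hypothesis b_const : forall i, ~~ P i -> b i = (eps (b i))%:A.
Hypothesis b_eps : forall i, P i -> eps (b i) = 0.
Hypothesis b_indep : forall (s : seq I) (c : I -> R), uniq s -> all P s ->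
  (forall v, \sum_(i <- s) c i * ev v (b i) = 0) -> {in s, forall i, c i = 0}.
Hypothesis ev_unique : forall v (chi : A -> R),
  linear_for *%R chi -> monoid_morphism chi -> (forall x, chi (var x) = v x) ->
  forall a, chi a = ev v a.

(* The functions on pairs of points induced by the tensor square of A.        *)
Definition split_fun (f : (X -> R) -> (X -> R) -> R) : Prop :=
  exists s : seq (A * A), forall v w, f v w = \sum_(t <- s) ev v t.1 * ev w t.2.

Lemma split_fun_cst c : split_fun (fun _ _ => c).
Proof.
exists [:: (c%:A, 1)] => v w.
by rewrite big_seq1 linearZ /= !rmorph1 !mulr1.
Qed.

Lemma split_fun_fst a : split_fun (fun v _ => ev v a).
Proof. by exists [:: (a, 1)] => v w; rewrite big_seq1 rmorph1 mulr1. Qed.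

Lemma split_fun_snd a : split_fun (fun _ w => ev w a).
Proof. by exists [:: (1, a)] => v w; rewrite big_seq1 rmorph1 mul1r. Qed.

Lemma split_funD f g : split_fun f -> split_fun g ->
  split_fun (fun v w => f v w + g v w).
Proof.
by case=> s hf [t hg]; exists (s ++ t) => v w; rewrite big_cat hf hg.
Qed.

Lemma split_funM f g : split_fun f -> split_fun g ->
  split_fun (fun v w => f v w * g v w).
Proof.
case=> s hf [t hg]; exists [seq (x.1 * y.1, x.2 * y.2) | x <- s, y <- t] => v w.
rewrite big_allpairs_dep /= hf hg mulr_suml; apply: eq_bigr => x _.
by rewrite mulr_sumr; apply: eq_bigr => y _; rewrite !rmorphM mulrACA.
Qed.

Lemma split_fun_sum J (r : seq J) (F : J -> (X -> R) -> (X -> R) -> R) :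
    (forall j, split_fun (F j)) ->
  split_fun (fun v w => \sum_(j <- r) F j v w).
Proof.
move=> hF; elim: r => [|j r [s hs]].
  by exists [::] => v w; rewrite !big_nil.
have [t ht] := split_funD (hF j) (ex_intro _ s hs).
by exists t => v w; rewrite big_cons ht.
Qed.

Lemma split_fun_prod J (r : seq J) (F : J -> (X -> R) -> (X -> R) -> R) :
    (forall j, split_fun (F j)) ->
  split_fun (fun v w => \prod_(j <- r) F j v w).
Proof.
move=> hF; elim: r => [|j r [s hs]].
  have [t ht] := split_fun_cst 1; exists t => v w.
  by rewrite big_nil; exact: ht.
have [t ht] := split_funM (hF j) (ex_intro _ s hs).
by exists t => v w; rewrite big_cons ht.
Qed.

(** Existence rests on this closure under substitution, applied with [phi] the coordinates of
    [tau_point]. It holds for different reasons over Z and over F_p. *)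
Hypothesis ev_comp : forall (phi : X -> (X -> R) -> (X -> R) -> R) (a : A),
  (forall x, split_fun (phi x)) ->
  split_fun (fun v w => ev (fun x => phi x v w) a).

Fact augproj_subproof (a : A) : a - (eps a)%:A \in aug_pred eps.
Proof.
by rewrite unfold_in /aug_pred linearB linearZ /= rmorph1 [_ *: _]mulr1 subrr.
Qed.
Definition augproj (a : A) : M := AugIdeal (augproj_subproof a).

Lemma eps_aug (a : M) : eps (aug_val a) = 0.
Proof. exact/eqP/(valP a). Qed.

Lemma aug_val_sum J (r : seq J) (F : J -> M) :
  aug_val (\sum_(i <- r) F i) = \sum_(i <- r) aug_val (F i).
Proof. exact: (raddf_sum (\val : M -> A)). Qed.

Lemma augproj_linear : linear augproj.
Proof.
move=> c x y; apply: val_inj; rewrite /= linearP /= scalerDl scalerBr.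
by rewrite opprD addrACA scalerA.
Qed.

HB.instance Definition _ := GRing.isLinear.Build R A M *:%R augproj
  augproj_linear.

Lemma augprojK (a : M) : augproj (aug_val a) = a.
Proof. by apply: val_inj; rewrite /= eps_aug scale0r subr0. Qed.

Lemma augproj_b i : P i -> aug_val (augproj (b i)) = b i.
Proof. by move=> /b_eps e; rewrite /= e scale0r subr0. Qed.

(** Projecting an expansion in [b] to m kills the constant members and fixes the others. *)
Lemma aug_span (a : M) : exists2 s : seq (R * I), all P [seq w.2 | w <- s] &
  a = \sum_(w <- s) w.1 *: augproj (b w.2).
Proof.
have [s aE] := b_span (aug_val a); exists [seq w <- s | P w.2].
  by rewrite all_map; apply/allP => w /=; rewrite mem_filter => /andP[].
rewrite -[LHS]augprojK aE linear_sum /= big_filter [RHS]big_mkcond /=.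
apply: eq_bigr => w _; rewrite linearZ /=; case: ifPn => // nP.
rewrite (_ : augproj _ = 0) ?scaler0 //; apply: val_inj.
by rewrite /= -b_const ?subrr.
Qed.

Lemma aug_ev0 (a : M) : (forall v, ev v (aug_val a) = 0) -> a = 0.
Proof.
have [s /allP Ps aE] := aug_span a => a0.
have := @sum_undup I R M (fun i c => c *: augproj (b i)) s.
rewrite -aE => -> //; last by move=> i c1 c2; rewrite scalerBl.
rewrite big_seq big1 // => i i_s.
pose c i := \sum_(t <- s | t.2 == i) t.1; rewrite -/(c i).
suff -> : c i = 0 by rewrite scale0r.
apply: (@b_indep (undup [seq t.2 | t <- s]) c) i_s; first exact: undup_uniq.
  by apply/allP => j; rewrite mem_undup; exact: Ps.
move=> v; rewrite -[RHS](a0 v) aE.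
rewrite aug_val_sum linear_sum /=.
rewrite -(@sum_undup I R R (fun i c => c * ev v (b i))); last first.
  by move=> j c1 c2; rewrite mulrBl.
rewrite !big_seq; apply: eq_bigr => t /(map_f snd)/Ps Pt.
by rewrite linearZ /= b_eps // scale0r subr0.
Qed.

Definition ev2 (v w : X -> R) : T -> R :=
  @tlift2 _ _ R^o (fun x y : M => ev v (aug_val x) * ev w (aug_val y)).

Fact ev_mul_linearr v w (x : M) :
  linear_for *%R (fun y : M => ev v (aug_val x) * ev w (aug_val y)).
Proof. by move=> c y z; rewrite /= linearP /= mulrDr mulrCA. Qed.

Fact ev_mul_linearl v w (y : M) :
  linear_for *%R (fun x : M => ev v (aug_val x) * ev w (aug_val y)).
Proof. by move=> c x z; rewrite /= linearP /= mulrDl -mulrA. Qed.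

Lemma ev2_linear v w : linear_for *%R (ev2 v w).
Proof.
exact: (@tlift2_linear R M R^o _ (ev_mul_linearr v w) (ev_mul_linearl v w)).
Qed.
HB.instance Definition _ v w := GRing.isLinear.Build R T R *%R (ev2 v w)
  (ev2_linear v w).

Lemma ev2E v w a a' :
  ev2 v w (tin a * tin a') = ev v (aug_val a) * ev w (aug_val a').
Proof.
exact: (@tlift2E R M R^o _ a a' (ev_mul_linearr v w) (ev_mul_linearl v w)).
Qed.

(** Only the left factors are expanded: t is a sum of [b i] (x) [c i] with distinct i and [c i] in
    m. For fixed w, independence of the [b i] shows that every [c i] vanishes at w; then [aug_ev0]
    applies. *)
Lemma ev2_inj t : tdeg 2 t -> (forall v w, ev2 v w t = 0) -> t = 0.
Proof.
move=> ht t0.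
have [s Ps tE] : exists2 s : seq (M * I), all P [seq u.2 | u <- s] &
    t = \sum_(u <- s) tin (augproj (b u.2)) * tin u.1.
  move: t ht {t0}; apply: tdeg2_ind => [|c s t [us Ps ->] [ut Pt ->]|x y].
  - by exists [::]; rewrite ?big_nil.
  - exists ([seq (c *: u.1, u.2) | u <- us] ++ ut).
      by rewrite map_cat all_cat Pt -map_comp (eq_map (g := snd)) ?Ps.
    rewrite big_cat big_map scaler_sumr; congr (_ + _); apply: eq_bigr => u _.
    by rewrite linearZ /= scalerAr.
  have [s Ps xE] := aug_span x; exists [seq (u.1 *: y, u.2) | u <- s].
    by rewrite -map_comp (eq_map (g := snd)).
  rewrite {1}xE linear_sum mulr_suml big_map; apply: eq_bigr => u _.
  by rewrite !linearZ /= -scalerAl -scalerAr.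
pose D := undup [seq u.2 | u <- s].
pose c i : M := \sum_(u <- s | u.2 == i) u.1.
have tE' : t = \sum_(i <- D) tin (augproj (b i)) * tin (c i).
  rewrite tE (@sum_undup I M T (fun i a => tin (augproj (b i)) * tin a)) //.
  by move=> i x y; rewrite linearB mulrBr.
have PD : all P D by apply/allP => j; rewrite mem_undup; exact/allP.
rewrite tE' big_seq big1 // => i iD.
suff -> : c i = 0 by rewrite linear0 mulr0.
apply: aug_ev0 => w.
apply: (@b_indep D (fun i => ev w (aug_val (c i)))) iD => [||v] //.
  exact: undup_uniq.
rewrite -[RHS](t0 v w) tE' linear_sum !big_seq; apply: eq_bigr => j jD.
by rewrite /= ev2E augproj_b ?(allP PD) // mulrC.
Qed.

Lemma eq_ev2 s t : tdeg 2 s -> tdeg 2 t ->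
  (forall v w, ev2 v w s = ev2 v w t) -> s = t.
Proof.
move=> hs ht st; apply/eqP; rewrite -subr_eq0; apply/eqP.
apply: ev2_inj => [|v w]; first by apply: tdegD => //; exact: tdegN.
by rewrite linearB /= st subrr.
Qed.

Lemma cup1_21_deg s c : tdeg 2 s -> tdeg 2 (cup1_21 s (tin c) : T).
Proof.
move: s; apply: tdeg2_ind => [|k s t hs ht|x y].
- by rewrite (linear_at0 (cup1_21_linearl (tin c))); exact: tdeg0.
- by rewrite cup1_21_linearl; exact: tdegP.
by rewrite cup1_21E; apply: tdegD; exact: (tdegM (tdeg_tin _) (tdeg_tin _)).
Qed.

(** In A (x) A, cup_1 with c is multiplication by c (x) 1 + 1 (x) c. *)
Lemma ev2_cup1_21 v w s c : tdeg 2 s -> ev2 v w (cup1_21 s (tin c))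
  = ev2 v w s * (ev v (aug_val c) + ev w (aug_val c)).
Proof.
move: s; apply: tdeg2_ind => [|k s t hs ht|x y].
- by rewrite (linear_at0 (cup1_21_linearl (tin c))) linear0 mul0r.
- by rewrite cup1_21_linearl !linearP /= hs ht mulrDl mulrA.
by rewrite cup1_21E linearD /= !ev2E /= !rmorphM /=; ring.
Qed.

Lemma circ22_deg s t : tdeg 2 s -> tdeg 2 t -> tdeg 2 (circ22 s t : T).
Proof.
move=> hs ht; move: s hs; apply: tdeg2_ind => [|k s s' hs hs'|x y].
- by rewrite (linear_at0 (circ22_linearl t)); exact: tdeg0.
- by rewrite circ22_linearl; exact: tdegP.
move: t ht; apply: tdeg2_ind => [|k s s' hs hs'|x' y'].
- by rewrite (linear_at0 (circ22_linearr _)); exact: tdeg0.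
- by rewrite circ22_linearr; exact: tdegP.
by rewrite circ22E; exact: (tdegM (tdeg_tin _) (tdeg_tin _)).
Qed.

(** The operation circ is the product of A (x) A, so values multiply. *)
Lemma ev2_circ22 v w s t : tdeg 2 s -> tdeg 2 t ->
  ev2 v w (circ22 s t) = ev2 v w s * ev2 v w t.
Proof.
move=> hs ht; move: s hs; apply: tdeg2_ind => [|k s s' hs hs'|x y].
- by rewrite (linear_at0 (circ22_linearl t)) linear0 mul0r.
- by rewrite circ22_linearl !linearP /= hs hs' mulrDl mulrA.
move: t ht; apply: tdeg2_ind => [|k s s' hs hs'|x' y'].
- by rewrite (linear_at0 (circ22_linearr _)) linear0 mulr0.
- by rewrite circ22_linearr !linearP /= hs hs' mulrDr mulrCA.
by rewrite circ22E !ev2E /= !rmorphM /=; ring.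
Qed.

(** * Uniqueness and existence of the differential *)

Section Differential.
Variables (gen : X -> M) (tau : X -> T).
Hypothesis gen_var : forall x, aug_val (gen x) = var x.
Hypothesis tau_deg : forall x, tdeg 2 (tau x).

Definition tau_point (v w : X -> R) (x : X) : R := v x + w x - ev2 v w (tau x).

(** The homomorphism chi takes [var x] to [tau_point v w x], so by [ev_unique] it is evaluation at
    [tau_point v w]. *)
Lemma ev2_differential (d : T -> T) : linear d -> degree_one d ->
    (forall x, d (tin (gen x)) = tau x) -> cup1_d_formula d ->
  forall (a : M) v w, ev2 v w (d (tin a))
    = ev v (aug_val a) + ev w (aug_val a) - ev (tau_point v w) (aug_val a).
Proof.
move=> d_lin d_deg d_gen d_cup a v w.
(* The map chi of the header evaluated at (v, w), extended to A by chi 1 = 1. *)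
pose chi (q : A) : R :=
  ev v q + ev w q - (eps q : R) - ev2 v w (d (tin (augproj q))).
have chi_lin : linear_for *%R chi.
  move=> c x y; rewrite /chi !linearP d_lin !linearP /=.
  by rewrite /GRing.scale /=; ring.
(* Both [ev v] and [ev w] count the constant term; subtracting [eps] once corrects this. *)
have chi1 : chi 1 = 1.
  have -> : chi 1 = 1 + 1 - 1 - ev2 v w (d (tin (augproj 1))).
    by rewrite /chi !rmorph1.
  have -> : augproj 1 = 0 by apply: val_inj; rewrite /= rmorph1 scale1r subrr.
  by rewrite linear0 (linear_at0 d_lin) linear0 subr0 addrK.
have chiE (x : M) :
    chi (aug_val x) = ev v (aug_val x) + ev w (aug_val x) - ev2 v w (d (tin x)).
  by rewrite /chi augprojK eps_aug subr0.
(* This is the cup_1-d formula read at (v, w). *)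
have chiM (x y : M) : chi (aug_val x * aug_val y)
    = chi (aug_val x) * chi (aug_val y).
  have dx := d_deg _ _ (tdeg_tin x); have dy := d_deg _ _ (tdeg_tin y).
  rewrite -[aug_val x * _]/(aug_val (aug_mul x y)) !chiE -cup1_11E.
  rewrite (d_cup _ _ (tdeg_tin x) (tdeg_tin y)).
  rewrite !linearB !linearD linearN /= linearN /= !ev2E !ev2_cup1_21 //.
  by rewrite ev2_circ22 //= !rmorphM /=; ring.
(* Multiplicativity passes from m to A, the sum of the constants and m. *)
have chi_mon : monoid_morphism chi.
  split=> // x y; have qE q : q = eps q *: 1 + aug_val (augproj q).
    by rewrite /= addrC subrK.
  have chiA q : chi q = eps q + chi (aug_val (augproj q)).
    by rewrite {1}[q]qE chi_lin chi1 mulr1.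
  have -> : x * y = (eps x * eps y) *: 1 + (eps x *: aug_val (augproj y)
      + (eps y *: aug_val (augproj x)
          + aug_val (augproj x) * aug_val (augproj y))).
    rewrite {1}[x]qE {1}[y]qE; move: (aug_val _) (aug_val _) => x' y'.
    rewrite mulrDl !mulrDr -!scalerAl -!scalerAr !mul1r mulr1 scalerA.
    by rewrite !addrA.
  rewrite !chi_lin chi1 chiM (chiA x) (chiA y) /GRing.scale /=; ring.
have <- : chi (aug_val a) = ev (tau_point v w) (aug_val a).
  apply: ev_unique => // x.
  by rewrite -gen_var chiE gen_var !ev_var d_gen.
by rewrite chiE; ring.
Qed.

Lemma split_fun_ev2 (t : T) : tdeg 2 t -> split_fun (fun v w => ev2 v w t).
Proof.
case=> s ->; have [r hr] : split_fun (fun v w => \sum_(u <- s)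
    u.1 * (ev v (aug_val (tnth u.2 ord0)) * ev w (aug_val (tnth u.2 ord_max)))).
  apply: split_fun_sum => u; apply: split_funM (split_fun_cst _) _.
  exact: split_funM (split_fun_fst _) (split_fun_snd _).
exists r => v w; rewrite -hr linear_sum; apply: eq_bigr => -[c u] _ /=.
rewrite linearZ /=; case/tupleP: u => x u; case/tupleP: u => y u.
by rewrite tuple0 !big_cons big_nil mulr1 ev2E.
Qed.

Lemma split_fun_tau x : split_fun (fun v w => tau_point v w x).
Proof.
have [s hs] : split_fun (fun v w =>
    ev v (var x) + ev w (var x) + -1 * ev2 v w (tau x)).
  apply: split_funD; last exact: split_funM (split_fun_cst _) (split_fun_ev2 _).
  exact: split_funD (split_fun_fst _) (split_fun_snd _).
by exists s => v w; rewrite -hs !ev_var mulN1r.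
Qed.

(** Elements of m vanish at the point 0. Hence [tau_point] leaves w unchanged at (0, w) and v at (v,
    0). *)
Lemma ev2_aug0 v t : tdeg 2 t -> ev2 (fun=> 0) v t = 0 /\ ev2 v (fun=> 0) t = 0.
Proof.
move: t; apply: tdeg2_ind => [|c s t [hs hs'] [ht ht']|x y].
- by rewrite !linear0.
- by rewrite !linearP /= hs hs' ht ht' mulr0 addr0.
by rewrite !ev2E -!eps_ev !eps_aug mul0r mulr0.
Qed.

(** By [ev_comp], the function a([tau_point v w]) comes from A (x) A. Projecting both factors to m
    subtracts its restrictions a(w) and a(v) to the two axes and adds back its value 0 at the
    origin; up to sign this is the required function. *)
Lemma differential_exists (a : M) : exists t, tdeg 2 t /\ forall v w, ev2 v w t
    = ev v (aug_val a) + ev w (aug_val a) - ev (tau_point v w) (aug_val a).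
Proof.
have [s hs] := ev_comp (aug_val a) split_fun_tau.
exists (- \sum_(u <- s) tin (augproj u.1) * tin (augproj u.2)); split.
  apply/tdegN/tdeg_sum => u.
  exact: tdegM (tdeg_tin (augproj u.1)) (tdeg_tin (augproj u.2)).
move=> v w; pose o := (fun=> 0) : X -> R.
have tau0 u : tau_point o u = u /\ tau_point u o = u.
  split; apply/funext => x; have [h1 h2] := ev2_aug0 u (tau_deg x).
    by rewrite /tau_point h1 add0r subr0.
  by rewrite /tau_point h2 addr0 subr0.
transitivity (- (ev (tau_point v w) (aug_val a) - ev (tau_point o w) (aug_val a)
   - ev (tau_point v o) (aug_val a) + ev (tau_point o o) (aug_val a)));
  last first.
  rewrite (tau0 w).1 (tau0 v).2 (tau0 o).1 /o -eps_ev eps_aug; ring.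
rewrite !hs linearN linear_sum /=; congr (- _).
rewrite -!sumrN -!big_split /=; apply: eq_bigr => u _.
rewrite ev2E /= !linearB !linearZ /= !rmorph1.
by rewrite !eps_ev /GRing.scale /= /o; ring.
Qed.

Theorem differential_unique_exists : exists! d : T -> T,
  [/\ linear d, degree_one d, forall x, d (tin (gen x)) = tau x,
      cup1_d_formula d & graded_leibniz d].
Proof.
have [D hD] := choice differential_exists.
have Ddeg a := (hD a).1; have DE a := (hD a).2.
(* [D] is chosen pointwise, but [eq_ev2] determines [D a] by values that are linear in a. *)
have Dlin : linear D.
  move=> c x y; apply: eq_ev2; first exact: Ddeg; first exact: tdegP.
  by move=> v w; rewrite linearP /= !DE !linearP /= /GRing.scale /=; ring.
exists (tder D); split; first split.
- exact: tder_linear.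
- by move=> n t; exact: tder_degree.
- move=> x; rewrite tder_tin //; apply: eq_ev2 => // v w.
  by rewrite DE gen_var !ev_var /tau_point; ring.
- move=> _ _ /tdeg1_tin[x ->] /tdeg1_tin[y ->].
  rewrite cup1_11E !tder_tin //; apply: eq_ev2 => // [|v w].
    have xyD (x' y' : M) : tdeg 2 (tin x' * tin y' : T).
      exact: (tdegM (tdeg_tin _) (tdeg_tin _)).
    apply: tdegD; last by apply: tdegN; exact: circ22_deg.
    do 2![apply: tdegD; last exact: cup1_21_deg].
    by apply: tdegD; exact: tdegN.
  (* The values agree because evaluation at [tau_point v w] is multiplicative. *)
  rewrite !linearB !linearD linearN /= linearN /= !ev2E !ev2_cup1_21 //.
  by rewrite ev2_circ22 // !DE /= !rmorphM /=; ring.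
- by move=> m n u v; exact: tder_leibniz.
move=> d [d_lin d_deg d_gen d_cup d_leib].
apply: eq_leibniz => //; first exact: tder_linear.
  by move=> m n u v; exact: tder_leibniz.
move=> a; rewrite tder_tin //; apply: eq_ev2 => // [|v w].
  exact: d_deg (tdeg_tin a).
by rewrite DE (ev2_differential d_lin d_deg d_gen d_cup).
Qed.

End Differential.
End EvaluationAlgebra.

(** * Newton expansion of integer-valued polynomials *)

Lemma mulr_lin2 (K : comNzRingType) (B : comAlgType K) (k1 k2 : K)
    (u b b1 b2 c : B) :
  u * b = k1 *: b1 + k2 *: b2 -> u * (b * c) = k1 *: (b1 * c) + k2 *: (b2 * c).
Proof. by move=> ub; rewrite mulrA ub mulrDl -!scalerAl. Qed.

Section Newton.
Variable X : choiceType.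
Local Notation polyQ := {malg rat[{cmonom X}]}.

(** Exponent vectors serve both as indices of the products and as points at which these are
    evaluated. *)
Definition mbinom (v : X -> nat) (m : {cmonom X}) : nat :=
  (\prod_(x <- finsupp m) 'C(v x, m x))%N.

Lemma mbinom_diag (m : {cmonom X}) : mbinom m m = 1%N.
Proof. by rewrite /mbinom big1 // => x _; rewrite binn. Qed.

(** A nonzero product forces k x <= m x at every x, so the degree of k can reach that of m only if k
    = m. *)
Lemma mbinom_mdeg (k m : {cmonom X}) :
  mbinom m k != 0%N -> k != m -> (mdeg k < mdeg m)%N.
Proof.
move=> nz; have le_km x : (k x <= m x)%N.
  have [x_k|/fsfun_dflt-> //] := boolP (x \in finsupp k).
  rewrite leqNgt; apply: contra nz => lt_mk.
  by rewrite /mbinom (big_fsetD1 x) //= bin_small.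
apply: contraNltn => le_deg; apply/cmP => x.
pose D := (x |` (finsupp k `|` finsupp m))%fset.
have kD : (finsupp k `<=` D)%fset.
  by apply: fsubset_trans (fsubsetU1 _ _); exact: fsubsetUl.
have mD : (finsupp m `<=` D)%fset.
  by apply: fsubset_trans (fsubsetU1 _ _); exact: fsubsetUr.
move: le_deg; rewrite (mdegEw kD) (mdegEw mD).
rewrite (big_fsetD1 x) ?fset1U1 //=.
rewrite [in X in (_ <= X)%N](big_fsetD1 x) ?fset1U1 //=.
have : (\sum_(y <- (D `\ x)%fset) k y <= \sum_(y <- (D `\ x)%fset) m y)%N.
  by apply: leq_sum => y _.
move=> le1 le2; apply/eqP; rewrite eqn_leq le_km /=.
rewrite -(leq_add2r (\sum_(y <- (D `\ x)%fset) k y)) (leq_trans _ le2) //.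
by rewrite leq_add2l.
Qed.

(* Unitriangularity of the matrix with entries mbinom m k.                    *)
Lemma mbinom_coef (V : zmodType) (S : {pred V}) (s : seq {cmonom X})
    (c : {cmonom X} -> V) : zmod_closed S -> uniq s ->
  {in s, forall m : {cmonom X}, \sum_(k <- s) c k *+ mbinom m k \in S} ->
  {in s, forall m, c m \in S}.
Proof.
move=> S_closed; pose mixin := GRing.isZmodClosed.Build V S S_closed.
pose S' : zmodClosed V := HB.pack S mixin; rewrite -[S]/(S' : {pred V}).
move=> s_uniq hs m; have [n] := ubnP (mdeg m).
elim: n m => // n IHn m /ltnSE lemn m_s.
have := hs m m_s; rewrite (bigD1_seq m) // mbinom_diag mulr1n rpredDr //.
rewrite big_seq_cond; apply: rpred_sum => k /andP[k_s k_neq].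
have [->|nz] := eqVneq (mbinom m k) 0%N; first by rewrite mulr0n rpred0.
apply/rpredMn/IHn => //.
exact: leq_trans (mbinom_mdeg nz k_neq) lemn.
Qed.

Definition mbinomZ (m : {cmonom X}) : IntZ X :=
  \prod_(x <- finsupp m) binomZ x (m x).

Definition mbinomQ (m : {cmonom X}) : polyQ :=
  \prod_(x <- finsupp m) binomQ x (m x).

Lemma val_mbinomZ m : intz_val (mbinomZ m) = mbinomQ m.
Proof. exact: (rmorph_prod (\val : IntZ X -> polyQ)). Qed.

Lemma binomQ0 (x : X) : binomQ x 0 = 1.
Proof. by rewrite /binomQ big_ord0 invr1 scale1r. Qed.

Lemma mbinomQw (m : {cmonom X}) (D : {fset X}) : (finsupp m `<=` D)%fset ->
  mbinomQ m = \prod_(x <- D) binomQ x (m x).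
Proof.
move=> le; rewrite /mbinomQ (big_fset_incl _ le) //= => x _ /fsfun_dflt ->.
by rewrite binomQ0.
Qed.

(** A rearrangement of (n+1) binom(x, n+1) = (x - n) binom(x, n). *)
Lemma varQ_binomQ (x : X) n :
  varQ x * binomQ x n = n.+1%:R *: binomQ x n.+1 + n%:R *: binomQ x n.
Proof.
rewrite /binomQ big_ord_recr /=; set p := \prod_(i < n) _.
have n0 : n.+1%:R != 0 :> rat by rewrite pnatr_eq0.
have -> : (n.+1`!%:R)^-1 = n.+1%:R^-1 * (n`!%:R)^-1 :> rat.
  by rewrite factS natrM invfM.
move: (n`!%:R^-1 : rat) n0; set a : rat := n.+1%:R => k a0.
have -> : a *: ((a^-1 * k) *: (p * (varQ x - n%:R)))
    = k *: (p * (varQ x - n%:R)).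
  by rewrite scalerA mulrA (mulfV a0) mul1r.
have -> : (n%:R : rat) *: (k *: p) = k *: (p * n%:R).
  by rewrite scaler_nat mulr_natr scalerMnr.
by rewrite -scalerDr -mulrDr subrK -scalerAr mulrC.
Qed.

Lemma varQ_mbinomQ x (m : {cmonom X}) : varQ x * mbinomQ m
  = (m x).+1%:R *: mbinomQ (mmul m (ucm x)) + (m x)%:R *: mbinomQ m.
Proof.
pose D := (x |` finsupp m)%fset.
have mD : (finsupp m `<=` D)%fset by exact: fsubsetU1.
have mxD : (finsupp (mmul m (ucm x)) `<=` D)%fset by rewrite mdomD mdomU fsetUC.
pose p := \prod_(y <- (D `\ x)%fset) binomQ y (m y).
have -> : mbinomQ m = binomQ x (m x) * p.
  by rewrite (mbinomQw mD) (big_fsetD1 x) ?fset1U1.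
have -> : mbinomQ (mmul m (ucm x)) = binomQ x (m x).+1 * p.
  rewrite (mbinomQw mxD) (big_fsetD1 x (fset1U1 _ _)).
  rewrite (_ : mmul m (ucm x) x = (m x).+1); last by rewrite cmM cmUU addn1.
  apply: (congr1 ( *%R _)); apply: eq_big_seq => y.
  rewrite !inE => /andP[/negPf yx _]; apply: (congr1 (binomQ y)).
  by rewrite cmM cmU eq_sym yx addn0.
exact: mulr_lin2 (varQ_binomQ x (m x)).
Qed.

Lemma cm_neq1P (m : {cmonom X}) : m != mone -> exists x, x \in finsupp m.
Proof.
move=> m_neq1; apply/fset0Pn; apply: contra_neq m_neq1 => m0.
apply/eqP/cmP => i.
by rewrite cm1; apply: fsfun_dflt; rewrite m0.
Qed.

Lemma cmonom_ind (Q : {cmonom X} -> Prop) : Q mone ->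
  (forall m x, Q m -> Q (mmul m (ucm x))) -> forall m, Q m.
Proof.
move=> Q1 QM m; have [n] := ubnP (mdeg m).
elim: n m => // n IHn m /ltnSE lemn.
have [->//|/cm_neq1P[x x_m]] := eqVneq m mone.
have mE : m = mmul (divcm m (ucm x)) (ucm x).
  apply/eqP/cmP => y; rewrite cmM divcmE cmU.
  case: eqVneq => [<-|_]; last by rewrite subn0 addn0.
  by rewrite subnK // lt0n cmE_neq0.
rewrite mE; apply/QM/IHn; apply: leq_trans lemn.
by rewrite [in X in (_ < X)%N]mE mdegM mdegU addn1.
Qed.

(** The span contains 1 and, by [varQ_mbinomQ], is stable under multiplication by variables. *)
Lemma mbinomQ_span (f : polyQ) : in_span mbinomQ f.
Proof.
rewrite (monalgE f); elim/big_ind: _ => [|g h|m _].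
- exact: in_span0.
- exact: in_spanD.
rewrite malgU_scale; apply: in_spanZ; move: m {f}.
apply: cmonom_ind => [|m x IHm].
  by have := in_span_gen mbinomQ mone; rewrite /mbinomQ mdom1 big_seq_fset0.
have -> : << mmul m (ucm x) >> = varQ x * << m >> :> polyQ.
  by rewrite mulrC /varQ malgM_def fgmulUU mulr1.
apply: in_spanMl IHm => k; rewrite varQ_mbinomQ.
by apply: in_spanP; [exact: in_span_gen | apply/in_spanZ/in_span_gen].
Qed.

Lemma evalQ_scale v c (f : polyQ) : evalQ v (c *: f) = c * evalQ v f.
Proof. exact: mmapZ. Qed.

Lemma evalQ_binomQ (v : X -> nat) x n :
  evalQ (fun y => (v y)%:Z) (binomQ x n) = 'C(v x, n)%:R.
Proof.
set v' := fun y => _; rewrite /binomQ evalQ_scale rmorph_prod /=.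
have -> : \prod_(i < n) evalQ v' (varQ x - i%:R) = ((v x) ^_ n)%:R.
  elim: n => [|n IHn]; first by rewrite big_ord0 ffactn0.
  rewrite big_ord_recr /= IHn ffactnSr natrM rmorphB /= evalQ_var rmorph_nat.
  have [le_nv|lt_vn] := leqP n (v x); first by rewrite natrB.
  by rewrite ffact_small // !mul0r.
rewrite -bin_ffact natrM mulrC mulfK // pnatr_eq0 -lt0n; exact: fact_gt0.
Qed.

Lemma evalQ_mbinomQ (v : X -> nat) m :
  evalQ (fun y => (v y)%:Z) (mbinomQ m) = (mbinom v m)%:R.
Proof.
rewrite /mbinomQ rmorph_prod /mbinom natr_prod; apply: eq_bigr => x _.
exact: evalQ_binomQ.
Qed.

Lemma val_intz_scale (c : int) (q : IntZ X) :
  intz_val (c *: q) = c%:~R *: intz_val q.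
Proof. by rewrite scaler_int; exact: (raddfMz (\val : IntZ X -> polyQ)). Qed.

Lemma intz_val_sum J (r : seq J) (F : J -> IntZ X) :
  intz_val (\sum_(i <- r) F i) = \sum_(i <- r) intz_val (F i).
Proof. exact: (raddf_sum (\val : IntZ X -> polyQ)). Qed.

(** The rational coefficients are integers: q has integer values at the exponent vectors, and
    [mbinom_coef] solves the unitriangular system within the subgroup Z of Q. *)
Lemma mbinomZ_span (q : IntZ X) : in_span mbinomZ q.
Proof.
have [D [c [D_uniq qE]]] := in_span_uniq (mbinomQ_span q).
have c_int : {in D, forall m, c m \in Num.int}.
  apply: (@mbinom_coef _ (mem Num.int)) => //.
    by split=> [|x y]; [exact: rpred0 | exact: rpredB].
  move=> m _; have /asboolP/(_ (fun y => (m y)%:Z)) := valP q.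
  suff -> : \sum_(k <- D) c k *+ mbinom m k
      = evalQ (fun y => (m y)%:Z) (intz_val q) by [].
  rewrite qE raddf_sum; apply: eq_bigr => k _.
  by rewrite [RHS]evalQ_scale evalQ_mbinomQ mulr_natr.
exists [seq (numq (c m), m) | m <- D]; apply: val_inj.
rewrite /= qE big_map intz_val_sum; apply: eq_big_seq => m /c_int /intrP[z zE].
by rewrite val_intz_scale val_mbinomZ zE numq_int.
Qed.

End Newton.

(** * Evaluation over the integers *)

Section EvaluationZ.
Variable X : choiceType.

Definition evZ (v : X -> int) (q : IntZ X) : int := numq (evalQ v (intz_val q)).

Lemma evZE v q : (evZ v q)%:~R = evalQ v (intz_val q).
Proof.
by have /asboolP/(_ v)/intrP[m Em] := valP q; rewrite /evZ Em numq_int.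
Qed.

Fact evZ_is_linear v : linear_for *%R (evZ v).
Proof.
move=> c q r; apply: (@intr_inj rat); rewrite rmorphD rmorphM /= !evZE.
by rewrite -evalQ_scale -rmorphD /= -val_intz_scale.
Qed.
HB.instance Definition _ v := GRing.isLinear.Build int (IntZ X) int *%R (evZ v)
  (evZ_is_linear v).

Fact evZ_is_monoid_morphism v : monoid_morphism (evZ v).
Proof.
split=> [|q r]; apply: (@intr_inj rat); rewrite ?rmorphM /= !evZE.
  by rewrite !rmorph1.
by rewrite -rmorphM.
Qed.
HB.instance Definition _ v := GRing.isMonoidMorphism.Build (IntZ X) int (evZ v)
  (evZ_is_monoid_morphism v).

Lemma ctermZ_ev q : ctermZ q = evZ (fun=> 0) q.
Proof. by rewrite /evZ evalQ0. Qed.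

Lemma evZ_var v x : evZ v (varZ x) = v x.
Proof. by rewrite /evZ /= evalQ_var numq_int. Qed.

Lemma evZ_mbinomZ (v : X -> nat) m :
  evZ (fun x => (v x)%:Z) (mbinomZ m) = (mbinom v m)%:Z.
Proof.
by apply: (@intr_inj rat); rewrite evZE val_mbinomZ evalQ_mbinomQ.
Qed.

(** With the denominator cleared, a homomorphism into a ring where n! can be cancelled is determined
    on the binomial by its value at x. *)
Lemma fact_binomZ (x : X) n :
  n`!%:R * binomZ x n = \prod_(i < n) (varZ x - i%:R).
Proof.
pose f : {rmorphism IntZ X -> {malg rat[{cmonom X}]}} := \val.
have fI : injective f by exact: val_inj.
have fB : f (binomZ x n) = binomQ x n by [].
have fX : f (varZ x) = varQ x by [].
clearbody f; apply: fI; rewrite rmorphM rmorph_nat fB rmorph_prod.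
rewrite /binomQ -scalerAr mulr_natl -scaler_nat scalerA.
rewrite mulVf ?scale1r ?pnatr_eq0 -?lt0n ?fact_gt0 //.
by apply: eq_bigr => i _; rewrite rmorphB rmorph_nat fX.
Qed.

Lemma mbinomZ1 : mbinomZ (mone : {cmonom X}) = 1.
Proof. by rewrite /mbinomZ mdom1 big_seq_fset0. Qed.

Lemma ctermZ_mbinomZ (m : {cmonom X}) : m != mone -> ctermZ (mbinomZ m) = 0.
Proof.
move=> /cm_neq1P[x x_m].
rewrite /mbinomZ (big_fsetD1 x) //= rmorphM /= ctermZ_binom ?mul0r //.
by rewrite lt0n cmE_neq0.
Qed.

(** The same unitriangular system, now with the zero subgroup. *)
Lemma mbinomZ_indep (s : seq {cmonom X}) (c : {cmonom X} -> int) : uniq s ->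
  (forall v, \sum_(m <- s) c m * evZ v (mbinomZ m) = 0) ->
  {in s, forall m, c m = 0}.
Proof.
move=> s_uniq h m m_s; apply/eqP.
suff: {in s, forall m, c m \in pred1 (0 : int)} by move/(_ m m_s).
move=> {m m_s}; apply: mbinom_coef => // [|m _].
  by split=> [|x y /eqP-> /eqP->]; rewrite inE ?subrr.
rewrite inE -[X in _ == X](h (fun x => (m x)%:Z)); apply/eqP.
by apply: eq_bigr => k _; rewrite evZ_mbinomZ -mulr_natr natz.
Qed.

Lemma evZ_unique v (chi : IntZ X -> int) : linear_for *%R chi ->
  monoid_morphism chi -> (forall x, chi (varZ x) = v x) ->
  forall a, chi a = evZ v a.
Proof.
move=> chi_lin chi_mon chi_var a.
pose chiL := GRing.isLinear.Build int (IntZ X) int *%R chi chi_lin.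
pose chiM := GRing.isMonoidMorphism.Build (IntZ X) int chi chi_mon.
pose f : {lrmorphism IntZ X -> int | *%R} := HB.pack chi chiL chiM.
rewrite -[chi a]/(f a); have [s ->] := mbinomZ_span a.
rewrite !linear_sum; apply: eq_bigr => w _; rewrite !linearZ; congr (_ * _).
rewrite !rmorph_prod; apply: eq_bigr => x _; move: (w.2 x) => n.
have n0 : n`!%:R != 0 :> int by rewrite pnatr_eq0 -lt0n fact_gt0.
apply: (mulfI n0).
rewrite -[X in X * f _](rmorph_nat f) -[X in X * evZ v _](rmorph_nat (evZ v)).
rewrite -!rmorphM fact_binomZ !rmorph_prod; apply: eq_bigr => i _.
by rewrite !rmorphB !rmorph_nat /= evZ_var chi_var.
Qed.

End EvaluationZ.

(** * Substitution, and the theorem over Z *)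

(** The composite is formed over Q; its values at integer points are values of q at integer points,
    so it is integer-valued. *)
Lemma evZ_subst (X Y : choiceType) (psi : X -> IntZ Y) (q : IntZ X) :
  exists q' : IntZ Y, forall u, evZ u q' = evZ (fun x => evZ u (psi x)) q.
Proof.
pose f : {malg rat[{cmonom Y}]} := \sum_(m <- msupp (intz_val q))
  (intz_val q)@_m *: \prod_(x <- finsupp m) intz_val (psi x) ^+ m x.
have fE u : evalQ u f = evalQ (fun x => evZ u (psi x)) (intz_val q).
  rewrite raddf_sum [RHS]mmapE; apply: eq_bigr => m _.
  rewrite [LHS]evalQ_scale rmorph_prod; congr (_ * _); apply: eq_bigr => x _.
  by rewrite rmorphXn evZE.
have f_int : f \in @int_valued Y.
  by apply/asboolP => u; rewrite fE -evZE intr_int.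
by exists (MkIntZ f_int) => u; rewrite /evZ /= fE.
Qed.

Lemma evZ_binomZ_eq (X Y : choiceType) (v : X -> int) (u : Y -> int) x y n :
  v x = u y -> evZ v (binomZ x n) = evZ u (binomZ y n).
Proof.
move=> vu; have n0 : n`!%:R != 0 :> int by rewrite pnatr_eq0 -lt0n fact_gt0.
apply: (mulfI n0).
rewrite -[X in X * evZ v _](rmorph_nat (evZ v)).
rewrite -[X in X * evZ u _](rmorph_nat (evZ u)).
rewrite -!rmorphM !fact_binomZ !rmorph_prod; apply: eq_bigr => i _.
by rewrite !rmorphB !rmorph_nat /= !evZ_var vu.
Qed.

Section CompositionZ.
Variable X : choiceType.

Definition evZ_morph (v : X -> int) : {lrmorphism IntZ X -> int | *%R} := evZ v.

(* Composites are integer-valued on X + X, hence integral combinations of     *)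
(* products of binomials, each of which splits.                               *)
Lemma evZ_comp (phi : X -> (X -> int) -> (X -> int) -> int) (a : IntZ X) :
  (forall x, split_fun evZ_morph (phi x)) ->
  split_fun evZ_morph (fun v w => evZ (fun x => phi x v w) a).
Proof.
move=> /choice[s hs].
(* Pullbacks along the two inclusions X -> X + X: at a joined point they see only v, respectively
   only w. *)
have [l hl] := choice (evZ_subst (fun x => varZ (inl x) : IntZ (X + X)%type)).
have [r hr] := choice (evZ_subst (fun x => varZ (inr x) : IntZ (X + X)%type)).
pose psi x := \sum_(t <- s x) l t.1 * r t.2.
pose join (v w : X -> int) (y : X + X) :=
  match y with inl x => v x | inr x => w x end.
have joinl v w b : evZ (join v w) (l b) = evZ v b.
  by rewrite hl; congr (evZ _ b); apply/funext => z; rewrite evZ_var.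
have joinr v w b : evZ (join v w) (r b) = evZ w b.
  by rewrite hr; congr (evZ _ b); apply/funext => z; rewrite evZ_var.
have psiE v w x : evZ (join v w) (psi x) = phi x v w.
  rewrite hs raddf_sum; apply: eq_bigr => t _.
  by rewrite [LHS](rmorphM (evZ (join v w))) /= joinl joinr.
have [q qE] := evZ_subst psi a.
suff [t ht] : split_fun evZ_morph (fun v w => evZ (join v w) q).
  exists t => v w; rewrite -ht qE; congr (evZ _ _).
  by apply/funext => x; rewrite psiE.
have [c qc] := mbinomZ_span q.
have [t ht] : split_fun evZ_morph (fun v w => \sum_(k <- c)
    k.1 * \prod_(y <- finsupp k.2) evZ (join v w) (binomZ y (k.2 y))).
  apply: split_fun_sum => k; apply: split_funM; first exact: split_fun_cst.
  apply: split_fun_prod => -[] x.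
    have [t ht] := split_fun_fst evZ_morph (binomZ x (k.2 (inl x))).
    by exists t => v w; rewrite -(ht v w); exact: evZ_binomZ_eq.
  have [t ht] := split_fun_snd evZ_morph (binomZ x (k.2 (inr x))).
  by exists t => v w; rewrite -(ht v w); exact: evZ_binomZ_eq.
exists t => v w; rewrite -ht qc linear_sum; apply: eq_bigr => k _.
by rewrite linearZ /= rmorph_prod.
Qed.

Lemma differentialZ (tau : X -> TZ X) : (forall x, tdeg 2 (tau x)) ->
  exists! d : TZ X -> TZ X,
    [/\ linear d, degree_one d, forall x, d (tin (genZ x)) = tau x,
        cup1_d_formula d & graded_leibniz d].
Proof.
apply: (@differential_unique_exists _ _ _ _ evZ_morph (@varZ X) _
  (@mbinomZ X) (predC1 mone)) => //.
- exact: ctermZ_ev.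
- exact: evZ_var.
- exact: mbinomZ_span.
- by move=> m; rewrite negbK => /eqP->; rewrite mbinomZ1 rmorph1 scale1r.
- exact: ctermZ_mbinomZ.
- by move=> s c s_uniq _; exact: mbinomZ_indep.
- exact: evZ_unique.
- exact: evZ_comp.
Qed.

End CompositionZ.

(** * Evaluation over a prime field *)

Lemma evZ_binomZ (X : choiceType) (v : X -> nat) x n :
  evZ (fun y => (v y)%:Z) (binomZ x n) = 'C(v x, n)%:Z.
Proof. by apply: (@intr_inj rat); rewrite evZE evalQ_binomQ. Qed.

Section EvaluationFp.
Variables (p : nat) (p_pr : prime p) (X : choiceType).
Local Notation A := (IntFp p_pr X).
Local Notation red := (@redp p p_pr X).

(** The lift to {0, ..., p-1}. At such points binom(x, n) vanishes for n >= p, so evaluation modulo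
    p factors through the quotient ([evFp_red]). *)
Definition natpt (v : X -> 'F_p) (x : X) : nat := v x.

Lemma natpt_lt v x : (natpt v x < p)%N.
Proof. by rewrite -[X in (_ < X)%N](Fp_cast p_pr); exact: ltn_ord. Qed.

Definition evFp (v : X -> 'F_p) (q : A) : 'F_p :=
  (evZ (fun x => (natpt v x)%:Z)
    (repr (q : {ideal_quot binom_ideal p_pr})))%:~R.

Lemma evFp_red v q : evFp v (red q) = (evZ (fun x => (natpt v x)%:Z) q)%:~R.
Proof.
apply/eqP; rewrite -subr_eq0 -rmorphB /= -rmorphB /=.
have: repr (\pi_({ideal_quot binom_ideal p_pr}) q) - q \in binom_ideal p_pr.
  by rewrite Quotient.idealrBE reprK.
case/asboolP=> s [r [/allP le_p ->]].
have p0 : p%:R = 0 :> 'F_p by rewrite (pchar_Fp_0 p_pr).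
rewrite rmorphD rmorph_sum rmorphM /= rmorph_nat.
rewrite big_seq big1 => [|t /le_p le_pt].
  by rewrite add0r rmorphM rmorph_nat /= p0 mul0r.
rewrite rmorphM /= evZ_binomZ bin_small ?mulr0 //.
exact: leq_trans (natpt_lt v _) le_pt.
Qed.

Lemma redp_nat_scale (c : 'F_p) q : c *: red q = red (c%:R * q).
Proof. by rewrite rmorphM rmorph_nat. Qed.

Fact evFp_is_linear v : linear_for *%R (evFp v).
Proof.
move=> a q r; have [q' ->] := redp_surj q; have [r' ->] := redp_surj r.
rewrite redp_nat_scale -rmorphD !evFp_red rmorphD rmorphM /= rmorph_nat.
by rewrite rmorphD rmorphM /= rmorph_nat natr_Zp.
Qed.
HB.instance Definition _ v := GRing.isLinear.Build 'F_p A 'F_p *%R (evFp v)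
  (evFp_is_linear v).

Fact evFp_is_monoid_morphism v : monoid_morphism (evFp v).
Proof.
split=> [|q r]; first by rewrite -(rmorph1 red) evFp_red !rmorph1.
have [q' ->] := redp_surj q; have [r' ->] := redp_surj r.
by rewrite -rmorphM !evFp_red !rmorphM.
Qed.
HB.instance Definition _ v := GRing.isMonoidMorphism.Build A 'F_p (evFp v)
  (evFp_is_monoid_morphism v).

Definition evFp_morph (v : X -> 'F_p) : {lrmorphism A -> 'F_p | *%R} := evFp v.

Lemma ctermFp_ev q : ctermFp q = evFp (fun=> 0) q.
Proof.
by have [r ->] := redp_surj q; rewrite ctermFp_red evFp_red ctermZ_ev.
Qed.

Lemma evFp_var v x : evFp v (varFp p_pr x) = v x.
Proof. by rewrite evFp_red evZ_var; exact: natr_Zp. Qed.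

Lemma redp_binomZ0 (x : X) n : (p <= n)%N -> red (binomZ x n) = 0.
Proof.
move=> le_pn; rewrite -(rmorph0 red); apply/eqP.
rewrite -[_ == _]Quotient.idealrBE subr0; apply/asboolP.
exists [:: (1, (x, n))], 0; rewrite /= le_pn big_seq1 mul1r mulr0 addr0.
by split.
Qed.

Lemma fact_Fp_neq0 n : (n < p)%N -> n`!%:R != 0 :> 'F_p.
Proof.
move=> lt_np; rewrite -(dvdn_pcharf (pchar_Fp p_pr)).
elim: n lt_np => [|n IHn] lt_np; first by rewrite dvdn1 neq_ltn prime_gt1 ?orbT.
by rewrite factS Euclid_dvdM // negb_or IHn ?(ltnW lt_np) // andbT gtnNdvd.
Qed.

(** For n < p the factorial is invertible modulo p; for n >= p the binomial is 0 in the quotient. *)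
Lemma lrmorph_binomFp (f : {lrmorphism A -> 'F_p | *%R}) x n :
  f (red (binomZ x n))
  = if (n < p)%N then n`!%:R^-1 * \prod_(i < n) (f (varFp p_pr x) - i%:R)
    else 0.
Proof.
case: ltnP => [lt_np|le_pn]; last by rewrite redp_binomZ0 ?rmorph0.
apply: (mulfI (fact_Fp_neq0 lt_np)).
rewrite mulVKf ?fact_Fp_neq0 // -[X in X * _](rmorph_nat f) -rmorphM.
rewrite -(rmorph_nat red) -rmorphM fact_binomZ !rmorph_prod.
by apply: eq_bigr => i _; rewrite !rmorphB !rmorph_nat.
Qed.

Definition mbinomFp (m : {cmonom X}) : A := red (mbinomZ m).

Lemma lrmorph_mbinomFp (f : {lrmorphism A -> 'F_p | *%R}) m :
  f (mbinomFp m) = \prod_(x <- finsupp m) f (red (binomZ x (m x))).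
Proof. by rewrite /mbinomFp /mbinomZ !rmorph_prod. Qed.

Lemma mbinomFp_span q : in_span mbinomFp q.
Proof.
have [r ->] := redp_surj q; have [s ->] := mbinomZ_span r.
exists [seq (w.1%:~R, w.2) | w <- s]; rewrite big_map rmorph_sum.
apply: eq_bigr => w _ /=; rewrite scaler_int.
exact: (raddfMz red).
Qed.

(** The index set of the basis of m: a product with some exponent at least p is 0, and the empty
    product is 1. *)
Definition reduced_exp (m : {cmonom X}) : bool :=
  (m != mone) && all (fun x => m x < p)%N (finsupp m).

Lemma mbinomFp_const m :
  ~~ reduced_exp m -> mbinomFp m = (ctermFp (mbinomFp m))%:A.
Proof.
rewrite negb_and negbK => /orP[/eqP->|/allPn[x x_m]].
  by rewrite /mbinomFp mbinomZ1 !rmorph1 scale1r.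
rewrite -leqNgt => le_pm; suff -> : mbinomFp m = 0 by rewrite rmorph0 scale0r.
rewrite /mbinomFp /mbinomZ rmorph_prod (big_fsetD1 x) //=.
by rewrite redp_binomZ0 ?mul0r.
Qed.

Lemma ctermFp_mbinomFp m : reduced_exp m -> ctermFp (mbinomFp m) = 0.
Proof. by case/andP=> m1 _; rewrite ctermFp_red ctermZ_mbinomZ. Qed.

Lemma mbinomFp_indep (s : seq {cmonom X}) (c : {cmonom X} -> 'F_p) :
  uniq s -> all reduced_exp s ->
  (forall v, \sum_(m <- s) c m * evFp v (mbinomFp m) = 0) ->
  {in s, forall m, c m = 0}.
Proof.
move=> s_uniq /allP Ps h m m_s; apply/eqP.
suff: {in s, forall m, c m \in pred1 (0 : 'F_p)} by move/(_ m m_s).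
move=> {m m_s}; apply: mbinom_coef => // [|m m_s].
  by split=> [|x y /eqP-> /eqP->]; rewrite inE ?subrr.
(* Exponents below p are their own lifts, so the matrix of values is the one over Z reduced modulo
   p. *)
have ptE : natpt (fun x => (m x)%:R : 'F_p) = m.
  apply/funext => x; rewrite /natpt val_Fp_nat // modn_small //.
  have [_ /allP m_lt] := andP (Ps m m_s).
  have [/m_lt//|/fsfun_dflt->] := boolP (x \in finsupp m).
  exact: prime_gt0.
rewrite inE -[X in _ == X](h (fun x => (m x)%:R)); apply/eqP.
by apply: eq_bigr => k _; rewrite evFp_red ptE evZ_mbinomZ -mulr_natr.
Qed.

Lemma evFp_unique v (chi : A -> 'F_p) : linear_for *%R chi ->
  monoid_morphism chi -> (forall x, chi (varFp p_pr x) = v x) ->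
  forall a, chi a = evFp v a.
Proof.
move=> chi_lin chi_mon chi_var a.
pose chiL := GRing.isLinear.Build 'F_p A 'F_p *%R chi chi_lin.
pose chiM := GRing.isMonoidMorphism.Build A 'F_p chi chi_mon.
pose f : {lrmorphism A -> 'F_p | *%R} := HB.pack chi chiL chiM.
rewrite -[chi a]/(f a) -[evFp v a]/(evFp_morph v a).
have [s ->] := mbinomFp_span a.
rewrite !linear_sum; apply: eq_bigr => w _; rewrite !linearZ; congr (_ * _).
rewrite [LHS](lrmorph_mbinomFp f) [RHS](lrmorph_mbinomFp (evFp_morph v)).
apply: eq_bigr => x _; rewrite !lrmorph_binomFp.
by rewrite -[f _]/(chi _) chi_var [evFp_morph v _]evFp_var.
Qed.

(** Each binomial that survives is a polynomial over F_p in its variable, so the composite is a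
    polynomial in the functions [phi x], which split by hypothesis. *)
Lemma evFp_comp (phi : X -> (X -> 'F_p) -> (X -> 'F_p) -> 'F_p) (a : A) :
  (forall x, split_fun evFp_morph (phi x)) ->
  split_fun evFp_morph (fun v w => evFp (fun x => phi x v w) a).
Proof.
move=> phi_split; have [s ->] := mbinomFp_span a.
have [t ht] : split_fun evFp_morph (fun v w => \sum_(k <- s)
    k.1 * \prod_(x <- finsupp k.2)
      evFp (fun x => phi x v w) (red (binomZ x (k.2 x)))).
  apply: split_fun_sum => k; apply: split_funM; first exact: split_fun_cst.
  apply: split_fun_prod => x; move: (k.2 x) => n.
  have [t ht] : split_fun evFp_morph (fun v w =>
      (if (n < p)%N then n`!%:R^-1 else 0) * \prod_(i < n) (phi x v w - i%:R)).
    apply: split_funM; first exact: split_fun_cst.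
    apply: split_fun_prod => i; apply: split_funD => //; exact: split_fun_cst.
  exists t => v w; rewrite -ht -[evFp _ _]/(evFp_morph _ _) lrmorph_binomFp.
  by rewrite [evFp_morph _ _]evFp_var; case: ifP; rewrite ?mul0r.
exists t => v w; rewrite -ht -[evFp _ _]/(evFp_morph _ _) linear_sum.
apply: eq_bigr => k _; rewrite linearZ; congr (_ * _).
exact: (lrmorph_mbinomFp (evFp_morph _)).
Qed.

Lemma differentialFp (tau : X -> TFp p_pr X) : (forall x, tdeg 2 (tau x)) ->
  exists! d : TFp p_pr X -> TFp p_pr X,
    [/\ linear d, degree_one d, forall x, d (tin (genFp p_pr x)) = tau x,
        cup1_d_formula d & graded_leibniz d].
Proof.
apply: (@differential_unique_exists _ _ _ _ evFp_morph (@varFp p p_pr X) _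
  mbinomFp reduced_exp) => //.
- exact: ctermFp_ev.
- exact: evFp_var.
- exact: mbinomFp_span.
- exact: mbinomFp_const.
- exact: ctermFp_mbinomFp.
- exact: mbinomFp_indep.
- exact: evFp_unique.
- exact: evFp_comp.
Qed.

End EvaluationFp.

Theorem theorem7p3 (X : choiceType) :
  (forall tau : X -> TZ X, (forall x, tdeg 2 (tau x)) ->
     exists! d : TZ X -> TZ X,
       [/\ linear d, degree_one d, forall x, d (tin (genZ x)) = tau x,
           cup1_d_formula d & graded_leibniz d])
  /\
  (forall (p : nat) (p_pr : prime p) (tau : X -> TFp p_pr X),
     (forall x, tdeg 2 (tau x)) ->
     exists! d : TFp p_pr X -> TFp p_pr X,
       [/\ linear d, degree_one d, forall x, d (tin (genFp p_pr x)) = tau x,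
           cup1_d_formula d & graded_leibniz d]).
Proof.
by split=> [|p p_pr]; [exact: differentialZ | exact: differentialFp].
Qed.
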